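(* A triangulated sphere of dimension $\ge 2k-1$ is $k$-stellated if and only if it is the boundary of a $k$-shelled ball. In consequence, all $k$-stellated spheres of dimension $\ge 2k-1$ are $k$-stacked.
   Context: All simplicial complexes are finite and abstract, with the empty set as a face. A triangulated sphere/ball is a simplicial complex whose geometric carrier is homeomorphic to a sphere/ball. For a finite set $\alpha$, $\overline{\alpha}$ is the complex of all subsets of $\alpha$ and $\partial\alpha$ the complex of all proper subsets; $\dim\alpha=\#\alpha-1$. The join $X\ast Y$ (disjoint vertex sets) has as faces the disjoint unions of a face of $X$ and a face of $Y$. The standard sphere $S^d_{d+2}$ is $\partial\alpha$ with $\#\alpha=d+2$; the standard ball $B^{d}_{d+1}$ is $\overline{\alpha}$ with $\#\alpha=d+1$. Complexes are identified up to isomorphism. Bistellar moves: if $X$ is $d$-dimensional and $\alpha,\beta$ are disjoint nonempty sets with $\dim\alpha+\dim\beta=d$ such that the set of faces of $X$ contained in $\alpha\sqcup\beta$ is exactly $\overline{\alpha}\ast\partial\beta$, then $Y=(X\setminus(\overline\alpha\ast\partial\beta))\cup(\partial\alpha\ast\overline\beta)$ is obtained from $X$ by the bistellar move $\alpha\mapsto\beta$, of index $\dim\beta$ (if $\beta$ is a single vertex, it is a new vertex). For $0\le k\le d+1$, a $d$-dimensional complex is $k$-stellated if it is obtained from $S^d_{d+2}$ by a finite sequence of bistellar moves, each of index $<k$ ($S^d_{d+2}$ is the only $0$-stellated one). Shelling moves: for pure $d$-dimensional complexes $Y\subseteq X$, $X$ is obtained from $Y$ by the shelling move $\alpha\leadsto\beta$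 of index $\dim\beta$ if $\alpha$ and $\beta\ne\emptyset$ are disjoint faces of $X$, $\alpha\sqcup\beta$ is the only facet of $X$ that is not a facet of $Y$, and the set of faces of $Y$ contained in $\alpha\sqcup\beta$ is exactly $\overline\alpha\ast\partial\beta$ ($\alpha=\emptyset$ is allowed). For $0\le k\le d$, a $d$-dimensional pseudomanifold is $k$-shelled if it is obtained from $B^d_{d+1}$ by a finite sequence of shelling moves each of index $<k$ ($B^d_{d+1}$ is the only $0$-shelled one); $k$-shelled pseudomanifolds are balls. (A pseudomanifold is a pure complex in which each codimension-one face is in at most two facets and whose facets are connected via adjacency across codimension-one faces.) $\partial B$ is the pure subcomplex whose facets are the codimension-one faces lying in exactly one facet of $B$. For $0\le k\le d+1$, a triangulated $(d+1)$-ball $B$ is $k$-stacked if all faces of $B$ of dimension $\le d-k$ lie in $\partial B$; a triangulated $d$-sphere is $k$-stacked if it is the boundary of a $k$-stacked $(d+1)$-ball. *)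

(* Defs.v *)
From Stdlib Require Export Relation_Operators.
From mathcomp Require Export all_boot all_order all_algebra finmap.
From mathcomp Require Export all_classical all_reals all_analysis.
Export numFieldNormedType.Exports.

Set Implicit Arguments.
Unset Strict Implicit.
Unset Printing Implicit Defensive.

Import Order.TTheory GRing.Theory Num.Theory.

Local Open Scope fset_scope.
Local Open Scope ring_scope.

(* Vertices are labelled by natural numbers, so there is always a fresh vertex.
   Identifying complexes up to isomorphism is accounted for by admitting every
   labelling of the standard spheres and balls: an isomorphism between finite
   complexes on nat extends to a permutation of nat, which carries sequences of
   moves to sequences of moves. *)
Notation face := {fset nat}.
Notation complex := {fset face}.

(* Dimensions are integers: dim fset0 = -1, and S^-1 is the complex {fset0}. *)
Definition face_dim (a : face) : int := #|` a|%:Z - 1.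

Definition simplicial_complex (X : complex) : Prop :=
  fset0 \in X /\ forall a b : face, a \in X -> b `<=` a -> b \in X.

Definition has_dim (d : int) (X : complex) : Prop :=
  (exists2 a, a \in X & face_dim a = d) /\ {in X, forall a, face_dim a <= d}.

Definition simplex (a : face) : complex := fpowerset a.
Definition simplex_bd (a : face) : complex := fpowerset a `\ a.
Definition join (X Y : complex) : complex :=
  [fset a `|` b | a in X, b in Y].
Definition faces_within (X : complex) (s : face) : complex :=
  [fset f in X | f `<=` s].

Definition facets (X : complex) : complex :=
  [fset a in X | [forall b : X, (a `<=` val b) ==> (val b == a)]].

Definition pure (d : int) (X : complex) : Prop :=
  simplicial_complex X /\ {in facets X, forall a, face_dim a = d}.

Definition adjacent (d : int) (X : complex) (s t : face) : Prop :=
  [/\ s \in facets X, t \in facets X & face_dim (s `&` t) = d - 1].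

Definition pseudomanifold (d : int) (X : complex) : Prop :=
  [/\ pure d X,
      {in X, forall r, face_dim r = d - 1 ->
         (#|` [fset s in facets X | r `<=` s]| <= 2)%N}
    & {in facets X &, forall s t, clos_refl_trans face (adjacent d X) s t}].

(* Boundary of a d-dimensional complex. *)
Definition boundary (d : int) (B : complex) : complex :=
  [fset a in B | [exists r : B,
     [&& a `<=` val r, face_dim (val r) == d - 1
       & #|` [fset s in facets B | val r `<=` s]| == 1%N]]].

Definition standard_sphere (d : int) (X : complex) : Prop :=
  exists2 a, face_dim a = d + 1 & X = simplex_bd a.

Definition standard_ball (d : int) (X : complex) : Prop :=
  exists2 a, face_dim a = d & X = simplex a.

(* If b is a single vertex, the condition on faces_within already forces
   it not to be a vertex of X. *)
Definition bistellar_move (d : int) (a b : face) (X Y : complex) : Prop :=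
  [/\ has_dim d X,
      [/\ a != fset0, b != fset0, [disjoint a & b]
        & face_dim a + face_dim b = d],
      faces_within X (a `|` b) = join (simplex a) (simplex_bd b)
    & Y = (X `\` join (simplex a) (simplex_bd b))
            `|` join (simplex_bd a) (simplex b)].

Definition bistellar_step (d : int) (k : nat) (X Y : complex) : Prop :=
  exists a b, bistellar_move d a b X Y /\ face_dim b < k%:Z.

Definition stellated (d : int) (k : nat) (X : complex) : Prop :=
  k%:Z <= d + 1 /\
  exists2 S, standard_sphere d S
    & clos_refl_trans complex (bistellar_step d k) S X.

Definition shelling_move (d : int) (a b : face) (Y X : complex) : Prop :=
  [/\ [/\ pure d Y, pure d X & Y `<=` X],
      [/\ a \in X, b \in X, b != fset0 & [disjoint a & b]],
      facets X `\` facets Y = [fset a `|` b]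
    & faces_within Y (a `|` b) = join (simplex a) (simplex_bd b)].

Definition shelling_step (d : int) (k : nat) (Y X : complex) : Prop :=
  exists a b, shelling_move d a b Y X /\ face_dim b < k%:Z.

Definition shelled (d : int) (k : nat) (X : complex) : Prop :=
  [/\ k%:Z <= d, pseudomanifold d X
    & exists2 B, standard_ball d B
        & clos_refl_trans complex (shelling_step d k) B X].

Local Open Scope classical_set_scope.

Definition homeomorphic (T U : topologicalType) (A : set T) (B : set U) :=
  exists (f : T -> U) (g : U -> T),
    [/\ set_fun A B f, set_fun B A g,
        {in A, cancel f g}, {in B, cancel g f}
      & {within A, continuous f} /\ {within B, continuous g}].

(* Barycentric coordinates: the convex hull of the basis vectors e_v, v \in a. *)
Definition geom_simplex (R : realType) (a : face) : set {ptws nat -> R} :=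
  [set x | [/\ forall v, 0 <= x v, forall v, v \notin a -> x v = 0
             & \sum_(v <- a) x v = 1]].

Arguments geom_simplex : clear implicits.

Definition carrier (R : realType) (X : complex) : set {ptws nat -> R} :=
  \bigcup_(a in [set` X]) geom_simplex R a.

Arguments carrier : clear implicits.

(* Euclidean unit ball and sphere; the norm on 'rV_n in the library is the
   maximum norm. *)
Definition unit_ball (R : realType) (n : nat) : set 'rV[R]_n :=
  [set x | \sum_i x 0 i ^+ 2 <= 1].

Definition unit_sphere (R : realType) (n : nat) : set 'rV[R]_n :=
  [set x | \sum_i x 0 i ^+ 2 = 1].

Arguments unit_ball : clear implicits.
Arguments unit_sphere : clear implicits.

Definition triangulated_sphere (R : realType) (d : int) (X : complex) : Prop :=
  simplicial_complex X /\
  exists2 n : nat, d = n%:Z - 1 & homeomorphic (carrier R X) (unit_sphere R n).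

Definition triangulated_ball (R : realType) (d : int) (X : complex) : Prop :=
  simplicial_complex X /\
  exists2 n : nat, d = n%:Z & homeomorphic (carrier R X) (unit_ball R n).

(* d is the dimension of the ball, so the bound dim a <= d - 1 - k is the usual
   dim a <= (dimension of the boundary sphere) - k. *)
Definition stacked_ball (R : realType) (d : int) (k : nat) (B : complex)
    : Prop :=
  [/\ triangulated_ball R d B, k%:Z <= d
    & {in B, forall a, face_dim a <= d - 1 - k%:Z -> a \in boundary d B}].

Definition stacked_sphere (R : realType) (d : int) (k : nat) (X : complex)
    : Prop :=
  triangulated_sphere R d X /\
  exists2 B, stacked_ball R (d + 1) k B & X = boundary (d + 1) B.

(* Main.v *)
(* A shelling move of a ball B glues a simplex s = a |_| b on B along a disk of
   the boundary, and changes the boundary by the bistellar move a |-> b.  Such a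
   move on the boundary sphere X removes exactly the faces containing a, because
   the link of a in X is a strongly connected thin complex that contains the
   closed thin complex bd b, hence equals it; strong connectedness of all links
   is preserved by bistellar moves.  Conversely, a bistellar move a |-> b of index
   < k on X = bd B lifts to a shelling move of B as soon as b is not a face of B:
   B is k-stacked and dim b <= k - 1 <= d - k, so b would be a face of X.

   Topologically, the glued simplex is a cap over a star-shaped region: moving a
   point q of X with all a-coordinates positive in the direction from a to b for
   a time between 0 and min_a q sweeps out s.  Since min_a vanishes on the rest
   of X, rescaling the radii of the standard ball turns a parametrization of
   (B, X) into one of the glued pair. *)
From Stdlib Require Import Operators_Properties.
From mathcomp Require Import zify ring lra.
Require Import Defs.

Set Implicit Arguments.
Unset Strict Implicit.
Unset Printing Implicit Defensive.

Import Order.TTheory GRing.Theory Num.Theory.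

Local Open Scope fset_scope.
Local Open Scope nat_scope.

(** * Bistellar moves on normal pseudomanifolds *)

(** No combinatorial property is read off from the homeomorphism type: that links in a triangulated
    sphere are thin and strongly connected would call for homology. The property is checked on the
    boundary of a simplex and carried through the moves. Pseudomanifolds without a condition on
    links would not do: at a pinched face [a] the link may have parts besides the boundary of [b],
    and the move then leaves faces containing [a] behind although [a] is gone. For the same reason
    the ball comes with a parametrization of the pair formed by it and its boundary: a cap is
    attached along the sphere, so the homeomorphism type of the ball alone is too weak an invariant.
    Stackedness survives a lifted move because the faces that become interior all contain [a], which
    has at least [n + 1 - k] vertices. Cardinalities replace dimensions throughout: [n] is both the
    dimension of the ball and the number of vertices of a facet of its boundary sphere. *)

Lemma fsub_codim1 (s t : face) :
  s `<=` t -> #|` t| = #|` s|.+1 -> exists2 u, u \in t & s = t `\ u.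
Proof.
move=> st ct; have /eqP/cardfs1P[u tsu] : #|` t `\` s| = 1.
  by rewrite cardfsDS // ct subSnn.
exists u; first by have := fset11 u; rewrite -tsu inE => /andP[].
by rewrite -tsu fsetDK.
Qed.

Lemma card_fsetD1 (s : face) u n :
  u \in s -> #|` s| = n.+1 -> #|` s `\ u| = n.
Proof. by move=> us; rewrite (cardfsD1 u) us => -[]. Qed.

Lemma fsub_fsetD1 (f s : face) u : f `<=` s -> u \notin f -> f `<=` s `\ u.
Proof. by move=> fs uf; rewrite fsubsetD1 fs. Qed.

Lemma ridge_pair (r s : face) u v :
  u \in s -> v \in s -> u != v -> r `<=` s `\ u -> r `<=` s `\ v ->
  #|` s| = #|` r|.+2 -> r = (s `\ u) `\ v.
Proof.
move=> us vs uv ru rv cs; apply/eqP; rewrite eqEfcard fsub_fsetD1 //=; last first.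
  by move: rv; rewrite fsubsetD1 => /andP[].
have cu := card_fsetD1 us cs.
by rewrite (card_fsetD1 _ cu) // !inE eq_sym uv.
Qed.

(** A set two vertices short of [s] omits just two vertices, so only two sets lie strictly between.
    This makes the boundary of a simplex thin and settles ridges that lie in new facets only. *)
Lemma ridge_triple (r s s1 s2 s3 : face) :
  r `<=` s1 -> r `<=` s2 -> r `<=` s3 -> s1 `<=` s -> s2 `<=` s -> s3 `<=` s ->
  #|` s1| = #|` r|.+1 -> #|` s2| = #|` r|.+1 -> #|` s3| = #|` r|.+1 ->
  #|` s| = #|` r|.+2 -> [\/ s1 = s2, s1 = s3 | s2 = s3].
Proof.
move=> r1 r2 r3 s1s s2s s3s c1 c2 c3 cs.
have [|u1 u1s e1] := fsub_codim1 s1s; first by rewrite cs c1.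
have [|u2 u2s e2] := fsub_codim1 s2s; first by rewrite cs c2.
have [|u3 u3s e3] := fsub_codim1 s3s; first by rewrite cs c3.
have [->|n12] := eqVneq s1 s2; first by constructor 1.
have [->|n13] := eqVneq s1 s3; first by constructor 2.
have [->|n23] := eqVneq s2 s3; first by constructor 3.
have u12 : u1 != u2 by apply: contra n12 => /eqP u12; rewrite e1 e2 u12.
have u13 : u1 != u3 by apply: contra n13 => /eqP u13; rewrite e1 e3 u13.
have u23 : u2 != u3 by apply: contra n23 => /eqP u23; rewrite e2 e3 u23.
have rE : r = (s `\ u1) `\ u2 by apply: ridge_pair; rewrite -?e1 -?e2.
suff : u3 \in r by move=> /(fsubsetP r3); rewrite e3 fsetD11.
by rewrite rE !inE u3s (eq_sym u3) u23 (eq_sym u3) u13.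
Qed.

(** Facets are recognized by their number of vertices, one more than the dimension, instead of by
    maximality; in a pure complex the two agree. *)
Definition facet_over m (X : complex) (f s : face) :=
  [&& s \in X, #|` s| == m & f `<=` s].

Lemma facet_overP m (X : complex) (f s : face) :
  reflect [/\ s \in X, #|` s| = m & f `<=` s] (facet_over m X f s).
Proof.
by apply: (iffP and3P) => -[sX /eqP sm fs]; split=> //; apply/eqP.
Qed.

Definition pure_card m (X : complex) :=
  simplicial_complex X /\ forall f, f \in X -> exists s, facet_over m X f s.

(** Phrased as a coincidence among any three facets, the bound by two needs no counting;
    [card_fset_le2P] translates it back. *)
Definition thin m (X : complex) := forall r s1 s2 s3 : face, #|` r|.+1 = m ->
  facet_over m X r s1 -> facet_over m X r s2 -> facet_over m X r s3 ->
  [\/ s1 = s2, s1 = s3 | s2 = s3].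

(* Strong connectedness of the link of [f]: no proper nonempty set of facets
   containing [f] is closed under adjacency. *)
Definition strongly_connected m (X : complex) (f : face) :=
  forall P : face -> Prop,
    (forall s t, facet_over m X f s -> facet_over m X f t ->
       #|` s `&` t|.+1 = m -> P s -> P t) ->
  forall s t, facet_over m X f s -> facet_over m X f t -> P s -> P t.

Definition normal_pseudomanifold m (X : complex) :=
  [/\ pure_card m X, thin m X & forall f, strongly_connected m X f].

(** A form of the move without joins, in which membership is a boolean combination of inclusions. It
    removes the whole star of [a], so it agrees with the bistellar move only when that star lies in
    the union of [a] and [b]. *)
Definition flip (X : complex) (a b : face) : complex :=
  [fset f in X `|` simplex (a `|` b) | ~~ (a `<=` f)].

Lemma in_flip X a b f :
  (f \in flip X a b) = ~~ (a `<=` f) && ((f \in X) || (f `<=` a `|` b)).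
Proof. by rewrite !inE /= fpowersetE andbC. Qed.

Lemma pure_card_down m X : pure_card m X ->
  forall f g, f \in X -> g `<=` f -> g \in X.
Proof. by case=> -[_ h] _; exact: h. Qed.

Lemma fsubset_fsetD1P (f s : face) :
  f `<=` s -> reflect (exists2 u, u \in s & f `<=` s `\ u) (~~ (s `<=` f)).
Proof.
move=> fs; apply: (iffP (fsubsetPn _ _)) => -[u us uf]; exists u => //.
  exact: fsub_fsetD1.
by move: uf; rewrite fsubsetD1 => /andP[].
Qed.

Section Flip.
Variables (n : nat) (X : complex) (a b : face).
Hypotheses (nX : normal_pseudomanifold n X).
Hypotheses (b0 : b != fset0) (ab : [disjoint a & b]%fset).
Hypothesis cab : #|` a `|` b| = n.+1.
Hypothesis Xab : forall f, f `<=` a `|` b -> (f \in X) = ~~ (b `<=` f).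

Let notin_b u : u \in a -> u \notin b.
Proof. by move=> ua; apply/negP => ub; move/fdisjointP: ab => /(_ u ua); rewrite ub. Qed.

Let notin_a u : u \in b -> u \notin a.
Proof. by move=> ub; apply/negP => /notin_b; rewrite ub. Qed.

Let old_facet v : v \in b -> facet_over n X a ((a `|` b) `\ v).
Proof.
move=> vb; apply/facet_overP; split.
- rewrite Xab ?fsubD1set //; apply/negP => /fsubsetP/(_ v vb).
  by rewrite !inE eqxx.
- by apply: card_fsetD1 => //; rewrite inE vb orbT.
- by rewrite fsub_fsetD1 ?fsubsetUl // notin_a.
Qed.

Let b_notin s : s \in X -> ~~ (b `<=` s).
Proof.
move=> sX; apply/negP => bs; have [Xp _ _] := nX.
have : b \in X by exact: (pure_card_down Xp) bs.
by rewrite Xab ?fsubsetUr // fsubset_refl.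
Qed.

Lemma link_of_flip_face f : f \in X -> a `<=` f -> f `<=` a `|` b.
Proof.
move=> fX af; have [Xp Xt Xc] := nX.
have [s /facet_overP[sX cs fs]] := Xp.2 f fX.
apply: (fsubset_trans fs).
have /fset0Pn[v vb] := b0.
have sa : facet_over n X a s.
  by apply/facet_overP; split=> //; exact: fsubset_trans fs.
apply: (Xc a (fun s => s `<=` a `|` b) _ _ _ (old_facet vb) sa (fsubD1set _ _)).
move=> {f fX af s sX cs fs sa v vb} s t.
move=> /facet_overP[sX cs as_] /facet_overP[tX ct at_] cst sab.
have rs : s `&` t `<=` s := fsubsetIl _ _.
have ar : a `<=` s `&` t by rewrite fsubsetI as_.
have [|w ws rE] := fsub_codim1 rs; first by rewrite cs -cst.
have wb : w \in b.
  have := fsubsetP sab w ws; rewrite inE => /orP[wa|//].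
  by have := fsubsetP ar w wa; rewrite rE fsetD11.
have wab := old_facet wb.
(* The common ridge, which is [s] without [w], already lies in two facets inside the union of [a]
   and [b]: [s] and the one opposite to [w]. Thinness forces [t] to be one of them. *)
have [||||st|ws'|tw] := Xt (s `&` t) s t ((a `|` b) `\ w) => //.
- by apply/facet_overP.
- by apply/facet_overP; rewrite fsubsetIr.
- case/facet_overP: wab => p q _; apply/facet_overP; split=> //.
  by rewrite rE fsetSD.
- by rewrite -st.
- by move: ws; rewrite ws' fsetD11.
- by rewrite tw fsubD1set.
Qed.

Let a_notin s : s \in X -> #|` s| = n -> ~~ (s `<=` a `|` b) -> ~~ (a `<=` s).
Proof. by move=> sX cs; apply: contra; exact: link_of_flip_face. Qed.

Let new_facet u : u \in a -> facet_over n (flip X a b) b ((a `|` b) `\ u).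
Proof.
move=> ua; apply/facet_overP; split.
- rewrite in_flip fsubD1set orbT andbT; apply/negP => /fsubsetP/(_ u ua).
  by rewrite !inE eqxx.
- by apply: card_fsetD1 => //; rewrite inE ua.
- by rewrite fsub_fsetD1 ?fsubsetUr // notin_b.
Qed.

Let facet_flip f s : facet_over n (flip X a b) f s ->
  [/\ s \in X, ~~ (a `<=` s) & ~~ (s `<=` a `|` b)] \/
  exists2 u, u \in a & s = (a `|` b) `\ u.
Proof.
case/facet_overP; rewrite in_flip => /andP[nas sX] cs fs.
have [sab|nsab] := boolP (s `<=` a `|` b); last first.
  by left; move: sX; rewrite (negPf nsab) orbF.
right; have [|u uab sE] := fsub_codim1 sab; first by rewrite cab cs.
exists u => //; move: uab; rewrite inE => /orP[//|ub]; case/negP: nas.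
by rewrite sE fsub_fsetD1 ?fsubsetUl // notin_a.
Qed.

Let flip_pure : a != fset0 -> pure_card n (flip X a b).
Proof.
move=> a0; have [Xp _ _] := nX; split.
  split.
    rewrite in_flip fsub0set orbT andbT fsubset0 //.
  move=> f g; rewrite !in_flip => /andP[naf /orP[fX|fab]] gf.
    rewrite (pure_card_down Xp fX gf) andbT; apply: contra naf => ag.
    exact: fsubset_trans gf.
  rewrite (fsubset_trans gf fab) orbT andbT; apply: contra naf => ag.
  exact: fsubset_trans gf.
move=> f fY; have [fab|nfab] := boolP (f `<=` a `|` b).
  move: fY; rewrite in_flip => /andP[/fsubsetPn[u ua uf] _].
  exists ((a `|` b) `\ u); case/facet_overP: (new_facet ua) => p q _.
  by apply/facet_overP; split=> //; exact: fsub_fsetD1.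
move: fY; rewrite in_flip (negPf nfab) orbF => /andP[naf fX].
have [s /facet_overP[sX cs fs]] := Xp.2 f fX; exists s.
have nsab : ~~ (s `<=` a `|` b) by apply: contra nfab; exact: fsubset_trans.
by apply/facet_overP; rewrite in_flip sX a_notin.
Qed.

Let old_flip f s : facet_over n (flip X a b) f s -> s \in X -> facet_over n X f s.
Proof. by case/facet_overP=> _ cs fs sX; apply/facet_overP. Qed.

Let new_notin u : u \in a -> (a `|` b) `\ u \notin X.
Proof.
by move=> /new_facet/facet_overP[_ _ h]; apply/negP => /b_notin; rewrite h.
Qed.

(** A ridge in two new facets contains [b], hence lies in no old facet. A ridge in one new facet and
    a surviving one misses some [v] of [b], so in [X] the removed facet opposite to [v] occupied one
    of its two places, leaving room for a single survivor. *)
Let flip_thin : thin n (flip X a b).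
Proof.
have [Xp Xt _] := nX.
move=> r s1 s2 s3 cr f1 f2 f3.
have two_new u v s : u \in a -> v \in a -> r `<=` (a `|` b) `\ u ->
    r `<=` (a `|` b) `\ v -> facet_over n X r s -> u = v.
  move=> ua va ru rv /facet_overP[sX _ rs]; apply/eqP/negPn/negP => uv.
  have rE : r = ((a `|` b) `\ u) `\ v.
    by apply: ridge_pair => //; rewrite ?inE ?ua ?va // cr.
  case/negP: (b_notin sX); apply: fsubset_trans rs; rewrite rE.
  by rewrite !fsub_fsetD1 ?fsubsetUr // notin_b.
have one_new u s t : u \in a -> r `<=` (a `|` b) `\ u ->
    facet_over n X r s -> facet_over n X r t ->
    ~~ (a `<=` s) -> ~~ (a `<=` t) -> s = t.
  move=> ua ru fs ft nas nat.
  have [sX _ rs] := facet_overP _ _ _ _ fs.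
  have /fsubsetPn[v vb vr] : ~~ (b `<=` r).
    by apply: contra (b_notin sX) => br; exact: fsubset_trans rs.
  have /facet_overP[p q q'] := old_facet vb.
  have fv : facet_over n X r ((a `|` b) `\ v).
    apply/facet_overP; split=> //; apply: fsub_fsetD1 => //.
    exact: fsubset_trans (fsubD1set _ u).
  have [e|e|//] := Xt r _ s t cr fv fs ft.
    by rewrite -e q' in nas.
  by rewrite -e q' in nat.
have [[X1 n1 _]|[u1 a1 e1]] := facet_flip f1;
have [[X2 n2 _]|[u2 a2 e2]] := facet_flip f2;
have [[X3 n3 _]|[u3 a3 e3]] := facet_flip f3.
- by apply: Xt cr _ _ _; apply: old_flip.
- constructor 1; apply: (one_new u3) => //; try exact: old_flip.
  by rewrite -e3; case/facet_overP: f3.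
- constructor 2; apply: (one_new u2) => //; try exact: old_flip.
  by rewrite -e2; case/facet_overP: f2.
- constructor 3; rewrite e2 e3; congr (_ `\ _).
  apply: (two_new _ _ s1) => //; first by rewrite -e2; case/facet_overP: f2.
    by rewrite -e3; case/facet_overP: f3.
  exact: old_flip.
- constructor 3; apply: (one_new u1) => //; try exact: old_flip.
  by rewrite -e1; case/facet_overP: f1.
- constructor 2; rewrite e1 e3; congr (_ `\ _).
  apply: (two_new _ _ s2) => //; first by rewrite -e1; case/facet_overP: f1.
    by rewrite -e3; case/facet_overP: f3.
  exact: old_flip.
- constructor 1; rewrite e1 e2; congr (_ `\ _).
  apply: (two_new _ _ s3) => //; first by rewrite -e1; case/facet_overP: f1.
    by rewrite -e2; case/facet_overP: f2.
  exact: old_flip.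
- case/facet_overP: f1 => _ c1 r1; case/facet_overP: f2 => _ c2 r2.
  case/facet_overP: f3 => _ c3 r3.
  apply: (@ridge_triple r (a `|` b)); rewrite ?c1 ?c2 ?c3 ?cab ?cr //;
    rewrite ?e1 ?e2 ?e3; exact: fsubD1set.
Qed.

Let new_adjacent u v : u \in a -> v \in a -> u != v ->
  #|` ((a `|` b) `\ u) `&` ((a `|` b) `\ v)|.+1 = n.
Proof.
move=> ua va uv.
have -> : ((a `|` b) `\ u) `&` ((a `|` b) `\ v) = ((a `|` b) `\ u) `\ v.
  by apply/fsetP => x; rewrite !inE andbACA andbb (andbC (x != u)) andbA.
have vab : v \in (a `|` b) `\ u by rewrite !inE eq_sym uv va.
have uab : u \in a `|` b by rewrite inE ua.
by have := card_fsetD1 uab cab; rewrite (cardfsD1 v) vab.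
Qed.

(* Each removed facet containing [f] is replaced by all the new facets
   containing [f], which are pairwise adjacent. *)
Let flip_connected f : strongly_connected n (flip X a b) f.
Proof.
have [Xp _ Xc] := nX.
move=> P closedP s t fs ft Ps.
have new_all u v : u \in a -> v \in a -> u \notin f -> v \notin f ->
    f `<=` a `|` b -> P ((a `|` b) `\ u) -> P ((a `|` b) `\ v).
  move=> ua va uf vf fab Pu; have [<-//|uv] := eqVneq u v.
  apply: closedP Pu; last exact: new_adjacent.
    case/facet_overP: (new_facet ua) => p q _; apply/facet_overP; split=> //.
    exact: fsub_fsetD1.
  case/facet_overP: (new_facet va) => p q _; apply/facet_overP; split=> //.
  exact: fsub_fsetD1.
have notf u z : facet_over n (flip X a b) f z -> z = (a `|` b) `\ u -> u \notin f.
  by move=> /facet_overP[_ _ + e]; rewrite e fsubsetD1 => /andP[].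
have fab u z : facet_over n (flip X a b) f z -> z = (a `|` b) `\ u -> f `<=` a `|` b.
  by move=> /facet_overP[_ _ + e]; rewrite e fsubsetD1 => /andP[].
(* [Q] transports [P] back to [X]: a surviving facet keeps its condition, a removed one stands for
   all the new facets over [f]. *)
pose Q z := if z `<=` a `|` b then
  forall u, u \in a -> u \notin f -> P ((a `|` b) `\ u) else P z.
have naf : ~~ (a `<=` f).
  case/facet_overP: fs => sY _ fs; apply: contraL sY => af.
  by rewrite in_flip (fsubset_trans af fs).
have closedQ z z' : facet_over n X f z -> facet_over n X f z' ->
    #|` z `&` z'|.+1 = n -> Q z -> Q z'.
  move=> /facet_overP[zX cz fz] /facet_overP[z'X cz' fz'] czz.
  have old w : w \in X -> #|` w| = n -> f `<=` w -> ~~ (w `<=` a `|` b) ->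
      facet_over n (flip X a b) f w.
    by move=> *; apply/facet_overP; rewrite in_flip a_notin //; split=> //;
      apply/orP; left.
  (* If a surviving facet [w] is adjacent to a removed [w'], the vertex [u] of [w'] outside [w] is
     in [a]: [w] misses some vertex of [a], while [w'] contains all of [a]. Then [w] is adjacent to
     the new facet opposite to [u]. *)
  have mixed w w' : w \in X -> #|` w| = n -> f `<=` w -> w' \in X ->
      #|` w'| = n -> f `<=` w' -> #|` w `&` w'|.+1 = n ->
      ~~ (w `<=` a `|` b) -> w' `<=` a `|` b ->
      exists u, [/\ u \in a, u \notin f & #|` w `&` ((a `|` b) `\ u)|.+1 = n].
    move=> wX cw fw w'X cw' fw' cww nw w'ab.
    have naw := a_notin wX cw nw.
    have [|u uw' rE] := fsub_codim1 (fsubsetIr w w'); first by rewrite cw' -cww.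
    have uw : u \notin w.
      by apply: contraTN isT => uw; have := fsetD11 u w'; rewrite -rE inE uw uw'.
    have ua : u \in a.
      have [|v vab w'E] := fsub_codim1 w'ab; first by rewrite cab cw'.
      have /fsubsetPn[x xa xw] := naw.
      have vb : v \in b.
        move: vab; rewrite inE => /orP[va|//]; case/negP: (b_notin w'X).
        by rewrite w'E fsub_fsetD1 ?fsubsetUr // notin_b.
      have xw' : x \in w'.
        by rewrite w'E !inE xa; rewrite andbT; apply: contraL vb => /eqP<-; exact: notin_b.
      have : x \notin w `&` w' by rewrite inE (negPf xw).
      by rewrite rE !inE xw' andbT negbK => /eqP<-.
    exists u; split=> //; first by apply: contra uw; exact/fsubsetP.
    apply/eqP; rewrite eqn_leq; apply/andP; split.
      rewrite -cw ltn_neqAle fsubset_leq_card ?fsubsetIl // andbT.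
      apply/eqP => e; case/negP: nw; apply: fsubset_trans (fsubD1set _ u).
      have : w `&` ((a `|` b) `\ u) == w by rewrite eqEfcard fsubsetIl e /=.
      by move=> /eqP<-; exact: fsubsetIr.
    rewrite -[X in X <= _]cww ltnS; apply: fsubset_leq_card.
    rewrite fsubsetI fsubsetIl /= fsub_fsetD1 //.
      exact: fsubset_trans (fsubsetIr _ _) w'ab.
    by rewrite inE (negPf uw).
  rewrite /Q; case: ifPn => zab; case: ifPn => z'ab //.
  - move=> Pnew.
    have [|u [ua uf cu]] := @mixed z' z z'X cz' fz' zX cz fz _ z'ab zab.
      by rewrite fsetIC.
    apply: closedP (Pnew u ua uf); last by rewrite fsetIC.
      case/facet_overP: (new_facet ua) => p q _; apply/facet_overP; split=> //.
      by rewrite fsub_fsetD1 // (fsubset_trans fz).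
    exact: old.
  - move=> Pz u ua uf.
    have [u' [ua' uf' cu]] := @mixed z z' zX cz fz z'X cz' fz' czz zab z'ab.
    have fab' : f `<=` a `|` b := fsubset_trans fz' z'ab.
    apply: (new_all _ _ ua' ua uf' uf fab').
    apply: closedP Pz => //; first exact: old.
    case/facet_overP: (new_facet ua') => p q _; apply/facet_overP; split=> //.
    exact: fsub_fsetD1.
  - move=> Pz; apply: closedP Pz => //; exact: old.
have newnew u z u' : facet_over n (flip X a b) f z -> u \in a -> z = (a `|` b) `\ u ->
    P z -> u' \in a -> u' \notin f -> P ((a `|` b) `\ u').
  move=> fz ua zE Pz u'a u'f; apply: (new_all u) => //; rewrite -?zE //.
    exact: notf zE.
  exact: fab zE.
(* No facet of [X] contains [b], so if [f] does, only new facets lie over [f] and connectedness of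
   [X] is not involved. *)
have [bf|/fsubsetPn[v vb vf]] := boolP (b `<=` f).
  have new z : facet_over n (flip X a b) f z -> exists2 u, u \in a & z = (a `|` b) `\ u.
    move=> fz; have [[zX _ _]|//] := facet_flip fz.
    by case/negP: (b_notin zX); case/facet_overP: fz => _ _; exact: fsubset_trans.
  have [u ua sE] := new s fs; have [u' ua' tE] := new t ft.
  by rewrite tE; apply: (newnew u s) => //; apply: notf tE.
(* [f] misses [v], so the removed facet opposite to [v] contains [f] *)
have repr z : facet_over n (flip X a b) f z -> exists2 z', facet_over n X f z' &
    (P z -> Q z') /\ (Q z' -> P z).
  move=> fz; have [[zX naz nz]|[u ua zE]] := facet_flip fz.
    by exists z; [exact: old_flip|rewrite /Q (negPf nz)].
  exists ((a `|` b) `\ v).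
    have /facet_overP[p q _] := old_facet vb.
    by apply/facet_overP; split=> //; rewrite fsub_fsetD1 // (fab u z).
  rewrite /Q fsubD1set; split.
    by move=> Pz u' u'a u'f; exact: (newnew u z).
  by rewrite zE; apply=> //; apply: notf zE.
have [s' fs' [+ _]] := repr s fs; have [t' ft' [_ +]] := repr t ft.
by move=> h1 h2; apply/h1/(Xc f Q closedQ s' t')/h2.
Qed.

Lemma normal_flip : a != fset0 -> normal_pseudomanifold n (flip X a b).
Proof. by move=> a0; split; [exact: flip_pure|exact: flip_thin|exact: flip_connected]. Qed.

End Flip.

(** * Faces, facets and boundaries *)

Lemma face_dimE m (s : face) : (face_dim s = m%:Z - 1)%R <-> #|` s| = m.
Proof. by rewrite /face_dim; move: #|` s| => x; lia. Qed.

Lemma face_dim_ridge m (d : int) (s : face) : (d = m%:Z - 1)%R ->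
  (face_dim s = d - 1)%R <-> #|` s|.+1 = m.
Proof. by move=> ->; rewrite /face_dim; move: #|` s| => x; lia. Qed.

Lemma joinC X Y : join X Y = join Y X.
Proof.
by apply/fsetP => f; apply/imfset2P/imfset2P => -[x xX [y yY ->]];
  exists y => //; exists x => //; rewrite fsetUC.
Qed.

Lemma in_join_bdr (a b f : face) : [disjoint a & b]%fset ->
  (f \in join (simplex a) (simplex_bd b)) = (f `<=` a `|` b) && ~~ (b `<=` f).
Proof.
move=> ab; apply/imfset2P/andP => [[x + [y +]]|[fab nbf]].
  rewrite !inE !fpowersetE => xa /andP[yb' yb] ->; split; first exact: fsetUSS.
  apply: contra yb' => bxy; rewrite eqEfsubset yb; apply/fsubsetP => v vb.
  have := fsubsetP bxy v vb; rewrite inE => /orP[vx|//].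
  by move/fdisjointP: ab => /(_ v (fsubsetP xa v vx)); rewrite vb.
exists (f `&` a); first by rewrite /= fpowersetE fsubsetIr.
exists (f `&` b); last by rewrite -fsetIUr; apply/esym/fsetIidPl.
rewrite !inE fpowersetE fsubsetIr andbT; apply: contra nbf => /eqP<-.
exact: fsubsetIl.
Qed.

Lemma in_join_bdl (a b f : face) : [disjoint a & b]%fset ->
  (f \in join (simplex_bd a) (simplex b)) = (f `<=` a `|` b) && ~~ (a `<=` f).
Proof. by move=> ab; rewrite joinC in_join_bdr 1?fdisjoint_sym // fsetUC. Qed.

Lemma faces_withinP (X : complex) (a b : face) : [disjoint a & b]%fset ->
  faces_within X (a `|` b) = join (simplex a) (simplex_bd b) <->
  forall f, f `<=` a `|` b -> (f \in X) = ~~ (b `<=` f).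
Proof.
move=> ab; split=> [/fsetP e f fab|e].
  by have := e f; rewrite in_join_bdr // !inE fab andbT.
apply/fsetP => f; rewrite in_join_bdr // !inE.
by have [fab|_] := boolP (f `<=` a `|` b); rewrite ?andbF // e // andbT.
Qed.

(** The two sides could differ only at faces of [X] that contain [a] and leave the union of [a] and
    [b]; [link_of_flip_face] excludes them. *)
Lemma flipE n X (a b : face) : normal_pseudomanifold n X ->
  b != fset0 -> [disjoint a & b]%fset -> #|` a `|` b| = n.+1 ->
  (forall f, f `<=` a `|` b -> (f \in X) = ~~ (b `<=` f)) ->
  (X `\` join (simplex a) (simplex_bd b)) `|` join (simplex_bd a) (simplex b)
    = flip X a b.
Proof.
move=> nX b0 ab cab Xab; apply/fsetP => f.
rewrite in_flip !inE in_join_bdr // in_join_bdl //.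
have [fab|nfab] := boolP (f `<=` a `|` b).
  by rewrite Xab //= negbK; case: (b `<=` f); case: (a `<=` f).
rewrite /= !orbF; have [fX|_] := boolP (f \in X); rewrite ?andbF ?andbT //.
by apply/esym; apply: contra nfab; apply: link_of_flip_face nX _ _ _ _ _ fX.
Qed.

Lemma facets_pure m (X : complex) s : pure_card m X ->
  (s \in facets X) = (s \in X) && (#|` s| == m).
Proof.
move=> [_ Xp]; rewrite !inE /=; have [sX|//] := boolP (s \in X).
apply/forallP/eqP => [h|cs [t tX]].
  have [t /facet_overP[tX ct st]] := Xp s sX.
  by have := h [` tX]; rewrite /= st /= => /eqP<-.
apply/implyP => /= st; rewrite eq_sym eqEfcard st /=.
have [u /facet_overP[_ cu tu]] := Xp t tX.
by rewrite cs -cu; apply: fsubset_leq_card.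
Qed.

Lemma facet_overE m (X : complex) (r s : face) : pure_card m X ->
  (s \in [fset s in facets X | r `<=` s]) = facet_over m X r s.
Proof.
by move=> Xp; rewrite in_fset /= [LHS]inE /= (facets_pure _ Xp) /facet_over andbA.
Qed.

Lemma pure_cardP m (d : int) (X : complex) : (d = m%:Z - 1)%R ->
  pure d X <-> pure_card m X.
Proof.
move=> dE; split=> [[Xs Xf]|Xp]; last first.
  split; first by case: Xp.
  by move=> s; rewrite (facets_pure _ Xp) /face_dim => /andP[_ /eqP->].
split=> // f fX.
pose s : X := [arg max_(s > [` fX] | f `<=` val s) #|` val s| ].
have [fs smax] : f `<=` val s /\ forall t : X, f `<=` val t -> #|` val t| <= #|` val s|.
  by rewrite /s; case: arg_maxnP => //= t.
exists (val s); apply/facet_overP; split=> //; first exact: valP.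
have : val s \in facets X.
  rewrite !inE /= (valP s) /=; apply/forallP => t; apply/implyP => st.
  by rewrite eq_sym eqEfcard st smax // (fsubset_trans fs).
by move=> /Xf; rewrite dE => /face_dimE.
Qed.

(** The ball has dimension [n], so its facets have [n.+1] vertices and its ridges, the facets of the
    boundary, have [n]. *)
Lemma boundaryP n (B : complex) (f : face) : pure_card n.+1 B ->
  reflect (exists r s, [/\ f `<=` r, #|` r| = n, facet_over n.+1 B r s
            & forall t, facet_over n.+1 B r t -> t = s])
          (f \in boundary n%:Z B).
Proof.
move=> Bp; have Bd := pure_card_down Bp.
have uniqP (r : face) : reflect (exists2 s, facet_over n.+1 B r s
            & forall t, facet_over n.+1 B r t -> t = s)
            (#|` [fset s in facets B | r `<=` s]| == 1).
  apply: (iffP (cardfs1P _)) => -[s].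
    move=> /fsetP e; exists s; first by rewrite -(facet_overE _ _ Bp) e fset11.
    by move=> t; rewrite -(facet_overE _ _ Bp) e inE => /eqP.
  move=> sr su; exists s; apply/fsetP => t; rewrite (facet_overE _ _ Bp) inE.
  by apply/idP/eqP => [/su|->].
rewrite !inE /=; apply: (iffP andP) => [[fB /existsP[[r rB] /= /and3P[fr rn]]]|].
  move=> /uniqP[s sr su]; exists r, s; split=> //.
  by move: rn => /eqP/face_dimE.
move=> [r [s [fr cr sr su]]]; have /facet_overP[sB _ rs] := sr.
have rB : r \in B by exact: Bd rs.
split; first exact: Bd fr.
apply/existsP; exists [` rB] => /=; rewrite fr /=; apply/andP; split.
  by apply/eqP/face_dimE.
by apply/uniqP; exists s.
Qed.

Lemma card_fset_le2P (A : complex) :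
  #|` A| <= 2 <-> {in A & A & A, forall s1 s2 s3, [\/ s1 = s2, s1 = s3 | s2 = s3]}.
Proof.
split=> [cA s1 s2 s3 A1 A2 A3|h].
  have [|n12] := eqVneq s1 s2; first by constructor.
  have [|n13] := eqVneq s1 s3; first by constructor.
  have [|n23] := eqVneq s2 s3; first by constructor.
  have : #|` s1 |` (s2 |` [fset s3])| <= #|` A|.
    by apply: fsubset_leq_card; rewrite !fsubUset !fsub1set A1 A2.
  by rewrite !cardfsU1 cardfs1 !inE negb_or n12 n13 n23; lia.
rewrite leqNgt; apply/negP => c3.
have /fset0Pn[s1 A1] : A != fset0 by rewrite -cardfs_gt0; lia.
have c2 : 1 < #|` A `\ s1| by move: c3; rewrite (cardfsD1 s1) A1.
have /fset0Pn[s2 A2] : A `\ s1 != fset0 by rewrite -cardfs_gt0; lia.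
have c1 : 0 < #|` (A `\ s1) `\ s2| by move: c2; rewrite (cardfsD1 s2) A2.
have /fset0Pn[s3] : (A `\ s1) `\ s2 != fset0 by rewrite -cardfs_gt0.
move: A2; rewrite !inE => /andP[n21 A2] /and3P[n32 n31 A3].
by case: (h s1 s2 s3) => // e; [rewrite e eqxx in n21|rewrite e eqxx in n31|rewrite e eqxx in n32].
Qed.

Lemma pseudomanifoldP m (d : int) (X : complex) : (d = m%:Z - 1)%R ->
  pseudomanifold d X <->
  [/\ pure_card m X, thin m X & strongly_connected m X fset0].
Proof.
move=> dE.
have over0 Y (s : face) : facet_over m Y fset0 s = (s \in Y) && (#|` s| == m).
  by rewrite /facet_over fsub0set andbT.
split=> [[/(pure_cardP _ dE) Xp Xt Xc]|[Xp Xt Xc]]; split=> //.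
- move=> r s1 s2 s3 cr f1 f2 f3.
  have rX : r \in X by case/facet_overP: f1 => [sX _]; exact: (pure_card_down Xp).
  have /card_fset_le2P h : #|` [fset s in facets X | r `<=` s]| <= 2.
    by apply: Xt => //; apply/(face_dim_ridge _ dE).
  by apply: h; rewrite (facet_overE _ _ Xp).
- move=> P closedP.
  have step s t : clos_refl_trans face (adjacent d X) s t -> P s -> P t.
    elim=> {s t} [s t [sX tX cst]|//|s t u _ h1 _ h2]; last by move/h1/h2.
    apply: closedP; rewrite ?over0 -?(facets_pure _ Xp) //.
    exact/(face_dim_ridge _ dE).
  move=> s t; rewrite !over0 -!(facets_pure _ Xp) => sX tX; apply: step.
  exact: Xc.
- exact/(pure_cardP _ dE).
- move=> r rX cr; apply/card_fset_le2P => s1 s2 s3; rewrite !(facet_overE _ _ Xp).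
  by apply: Xt; exact/(face_dim_ridge _ dE).
(* Reachability from [s] is itself a predicate closed under adjacency. *)
- move=> s t sX tX; apply: (Xc (clos_refl_trans face (adjacent d X) s)); last exact: rt_refl.
  + move=> u v; rewrite !over0 -!(facets_pure _ Xp) => uX vX cuv su.
    apply: rt_trans su _; apply: rt_step; split=> //.
    exact/(face_dim_ridge _ dE).
  + by rewrite over0 -(facets_pure _ Xp).
  + by rewrite over0 -(facets_pure _ Xp).
Qed.

(** * Gluing a simplex on a ball *)

Definition glue (B : complex) (s : face) : complex := B `|` simplex s.

Lemma in_glue B s f : (f \in glue B s) = (f \in B) || (f `<=` s).
Proof. by rewrite !inE fpowersetE. Qed.

Lemma facet_over_glue m B (s r t : face) : #|` s| = m ->
  facet_over m (glue B s) r t = facet_over m B r t || (t == s) && (r `<=` s).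
Proof.
move=> cs; rewrite /facet_over in_glue.
have [->|nts] := eqVneq t s; first by
  rewrite cs eqxx fsubset_refl orbT; case: (r `<=` s); rewrite ?orbT ?andbF.
rewrite orbF; have [ct|_] := eqVneq #|` t| m; rewrite ?andbF //=.
case: (boolP (t `<=` s)) => ts; rewrite ?orbF //.
by move: nts; rewrite eqEfcard ts cs ct leqnn.
Qed.

(** Thinness bounds the facets over a ridge from above only, so it descends from a shelled ball to
    all the earlier stages of its shelling. *)
Lemma thin_sub m (X Y : complex) :
  (forall f s, facet_over m X f s -> facet_over m Y f s) -> thin m Y -> thin m X.
Proof. by move=> XY Yt r s1 s2 s3 cr /XY f1 /XY f2 /XY f3; exact: Yt cr _ _ _. Qed.

Lemma boundary_sub n B f : f \in boundary n B -> f \in B.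
Proof. by rewrite !inE => /andP[]. Qed.

Section Glue.
Variables (n : nat) (B : complex) (a b : face).
Hypothesis Bp : pure_card n.+1 B.
Hypotheses (b0 : b != fset0) (ab : [disjoint a & b]%fset).
Hypothesis cab : #|` a `|` b| = n.+1.
Hypothesis Bab : forall f, f `<=` a `|` b -> (f \in B) = ~~ (b `<=` f).

Let ridge_in r : r `<=` a `|` b -> #|` r| = n -> r \in B ->
  exists2 v, v \in b & r = (a `|` b) `\ v.
Proof.
move=> rab cr; rewrite Bab // => nbr.
have [|v vab rE] := fsub_codim1 rab; first by rewrite cab cr.
exists v => //; move: vab; rewrite inE => /orP[va|//]; case/negP: nbr.
rewrite rE fsub_fsetD1 ?fsubsetUr //; apply/negP => vb.
by move/fdisjointP: ab => /(_ v va); rewrite vb.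
Qed.

Let opposite_card u : u \in a `|` b -> #|` (a `|` b) `\ u| = n.
Proof. by move=> uab; exact: card_fsetD1. Qed.

Let opposite_in v : v \in b -> (a `|` b) `\ v \in B.
Proof.
move=> vb; rewrite Bab ?fsubD1set //; apply/negP => /fsubsetP/(_ v vb).
by rewrite !inE eqxx.
Qed.

Let cap_notin : a `|` b \notin B.
Proof. by rewrite Bab // fsubsetUr. Qed.

Lemma glue_pure : pure_card n.+1 (glue B (a `|` b)).
Proof.
have [[B0 Bd] Bf] := Bp; split.
  split; first by rewrite in_glue B0.
  move=> f g; rewrite !in_glue => /orP[fB|fab] gf; apply/orP.
    by left; exact: Bd gf.
  by right; exact: fsubset_trans fab.
move=> f; rewrite in_glue => /orP[/Bf[s fs]|fab].
  by exists s; rewrite facet_over_glue // fs.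
by exists (a `|` b); rewrite facet_over_glue // eqxx fab orbT.
Qed.

Lemma facets_glue : facets (glue B (a `|` b)) `\` facets B = [fset a `|` b].
Proof.
apply/fsetP => s; rewrite in_fsetD (facets_pure _ Bp) (facets_pure _ glue_pure).
rewrite inE in_glue; have [->|ns] := eqVneq s (a `|` b).
  by rewrite (negPf cap_notin) fsubset_refl cab eqxx.
have [sB|_] := boolP (s \in B); first by case: eqP.
apply/negP => /andP[_ /andP[/= sab /eqP cs]].
by move: ns; rewrite eqEfcard sab cs cab leqnn.
Qed.

(** A ridge of the attaching disk lies in the cap as well, so by thinness of the glued complex it
    has just one facet in [B]. *)
Lemma boundary_within : thin n.+1 (glue B (a `|` b)) ->
  forall f, f `<=` a `|` b -> (f \in boundary n%:Z B) = ~~ (b `<=` f).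
Proof.
move=> Bt f fab; apply/idP/idP => [/boundary_sub|/fsubsetPn[v vb vf]].
  by rewrite Bab.
have vab : v \in a `|` b by rewrite inE vb orbT.
pose r := (a `|` b) `\ v.
have [s rs] := Bp.2 r (opposite_in vb).
apply/(boundaryP _ Bp); exists r, s; split=> //.
- exact: fsub_fsetD1.
- exact: opposite_card.
move=> t rt.
have [||||//|e|e] := Bt r t s (a `|` b).
- by rewrite opposite_card.
- by rewrite facet_over_glue // rt.
- by rewrite facet_over_glue // rs.
- by rewrite facet_over_glue // eqxx fsubD1set orbT.
- by case/negP: cap_notin; rewrite -e; case/facet_overP: rt.
- by case/negP: cap_notin; rewrite -e; case/facet_overP: rs.
Qed.

(** Only ridges of the attaching disk gain a facet, and these, lying in the boundary, had one
    before. *)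
Lemma thin_glue : thin n.+1 B ->
  (forall f, f `<=` a `|` b -> ~~ (b `<=` f) -> f \in boundary n%:Z B) ->
  thin n.+1 (glue B (a `|` b)).
Proof.
move=> Bt abB r s1 s2 s3 [cr]; rewrite !facet_over_glue //.
have cap_uniq s t : facet_over n.+1 B r s -> facet_over n.+1 B r t ->
    r `<=` a `|` b -> s = t.
  move=> fs ft rab.
  have rB : r \in B by case/facet_overP: fs => sB _; exact: (pure_card_down Bp).
  have /(boundaryP _ Bp)[r' [u [rr' cr' _ uu]]] : r \in boundary n%:Z B.
    by apply: abB => //; rewrite -Bab.
  have e : r = r' by apply/eqP; rewrite eqEfcard rr' cr cr' /=.
  by rewrite (uu s) -?e // (uu t) -?e.
move=> /orP[f1|/andP[/eqP e1 r1]] /orP[f2|/andP[/eqP e2 r2]]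
  /orP[f3|/andP[/eqP e3 r3]].
- exact: (Bt r _ _ _ (congr1 S cr)).
- by constructor 1; apply: cap_uniq.
- by constructor 2; apply: cap_uniq.
- by constructor 3; rewrite e2 e3.
- by constructor 3; apply: cap_uniq.
- by constructor 2; rewrite e1 e3.
- by constructor 1; rewrite e1 e2.
- by constructor 1; rewrite e1 e2.
Qed.

(** The cap is adjacent to a facet [t0] of [B] over one of the attaching ridges; they meet in no
    more than that ridge because the cap is not a face of [B]. *)
Lemma connected_glue : strongly_connected n.+1 B fset0 ->
  strongly_connected n.+1 (glue B (a `|` b)) fset0.
Proof.
move=> Bc P closedP; have /fset0Pn[v vb] := b0.
have vab : v \in a `|` b by rewrite inE vb orbT.
have [t0 ft0] := Bp.2 _ (opposite_in vb).
have /facet_overP[t0B ct0 rt0] := ft0.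
have new : facet_over n.+1 (glue B (a `|` b)) fset0 (a `|` b).
  by rewrite facet_over_glue // eqxx fsub0set orbT.
have o0 : facet_over n.+1 B fset0 t0 by apply/facet_overP.
have old s : facet_over n.+1 B fset0 s -> facet_over n.+1 (glue B (a `|` b)) fset0 s.
  by move=> fs; rewrite facet_over_glue // fs.
have adj : #|` t0 `&` (a `|` b)|.+1 = n.+1.
  have -> : t0 `&` (a `|` b) = (a `|` b) `\ v.
    apply/esym/eqP; rewrite eqEfcard fsubsetI rt0 fsubD1set /= opposite_card //.
    rewrite -ltnS -cab; apply: fproper_ltn_card.
    rewrite fproperEneq fsubsetIr andbT; apply/negP => /eqP e.
    by case/negP: cap_notin; apply: (pure_card_down Bp t0B); rewrite -e fsubsetIl.
  by rewrite opposite_card.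
have Q s t : facet_over n.+1 B fset0 s -> facet_over n.+1 B fset0 t -> P s -> P t.
  by apply: Bc => x y fx fy; apply: closedP; exact: old.
move=> s t; rewrite !facet_over_glue // !fsub0set !andbT.
move=> /orP[fs|/eqP->] /orP[ft|/eqP->] //.
- exact: Q.
- by move=> Ps; apply: (closedP t0) => //; [exact: old|exact: Q Ps].
- move=> Pab; apply: (Q t0) => //; apply: (closedP (a `|` b)) => //; first exact: old.
  by rewrite fsetIC.
Qed.

(** A ridge of the cap opposite to a vertex of [b] acquires a second facet and becomes interior; one
    opposite to a vertex of [a] contains [b], so it is new and lies in the cap only. By [star],
    every boundary ridge containing [a] is of the first kind. *)
Lemma boundary_glue :
  (forall f, f \in boundary n%:Z B -> a `<=` f -> f `<=` a `|` b) ->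
  boundary n%:Z (glue B (a `|` b)) = flip (boundary n%:Z B) a b.
Proof.
move=> star; apply/fsetP => f; rewrite in_flip.
have inner g : ~~ (a `<=` g) -> g `<=` a `|` b ->
    g \in boundary n%:Z (glue B (a `|` b)).
  move=> /fsubsetPn[u ua ug] gab.
  have uab : u \in a `|` b by rewrite inE ua.
  apply/(boundaryP _ glue_pure); exists ((a `|` b) `\ u), (a `|` b); split.
  - exact: fsub_fsetD1.
  - exact: opposite_card.
  - by rewrite facet_over_glue // eqxx fsubD1set orbT.
  move=> t; rewrite facet_over_glue // => /orP[/facet_overP[tB _ rt]|/andP[/eqP//]].
  have : (a `|` b) `\ u \in B by exact: (pure_card_down Bp) rt.
  rewrite Bab ?fsubD1set // fsub_fsetD1 ?fsubsetUr //.
  by move/fdisjointP: ab; apply.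
apply/(boundaryP _ glue_pure)/andP => [[r [s [fr cr rs uniq_s]]]|[naf /orP[]]].
- have [rab|nrab] := boolP (r `<=` a `|` b).
    have fab : f `<=` a `|` b by exact: fsubset_trans rab.
    rewrite fab orbT; split=> //; apply/negP => af.
    have rB : r \in B.
      rewrite Bab //; apply/negP => br; have : a `|` b `<=` r.
        by rewrite fsubUset br andbT; exact: fsubset_trans fr.
      by move/fsubset_leq_card; rewrite cab cr ltnn.
    have [t rt] := Bp.2 r rB.
    have e1 : t = s by apply: uniq_s; rewrite facet_over_glue // rt.
    have e2 : a `|` b = s.
      by apply: uniq_s; rewrite facet_over_glue // eqxx rab orbT.
    by case/negP: cap_notin; rewrite e2 -e1; case/facet_overP: rt.
  have rbd : r \in boundary n%:Z B.
    move: rs; rewrite facet_over_glue // (negPf nrab) andbF orbF => rs.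
    apply/(boundaryP _ Bp); exists r, s; split=> // t rt.
    by apply: uniq_s; rewrite facet_over_glue // rt.
  have fbd : f \in boundary n%:Z B.
    case/(boundaryP _ Bp): rbd => r' [t [rr' cr' rt tu]].
    by apply/(boundaryP _ Bp); exists r', t; split=> //; exact: fsubset_trans rr'.
  rewrite fbd; split=> //; apply/negP => af; case/negP: nrab; apply: star => //.
  exact: fsubset_trans fr.
- move=> fbd; have := fbd.
  case/(boundaryP _ Bp) => r [s [fr cr rs us]].
  have [rab|nrab] := boolP (r `<=` a `|` b).
    by apply/(boundaryP _ glue_pure)/inner => //; exact: fsubset_trans rab.
  exists r, s; split=> //; first by rewrite facet_over_glue // rs.
  move=> t; rewrite facet_over_glue // => /orP[|/andP[_ rab]]; first exact: us.
  by rewrite rab in nrab.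
- by move=> fab; apply/(boundaryP _ glue_pure)/inner.
Qed.

End Glue.

(** * The standard ball and the standard sphere *)

Section Simplex.
Variables (n : nat) (s : face).
Hypothesis cs : #|` s| = n.+1.

Lemma in_simplex_bd f : (f \in simplex_bd s) = (f `<=` s) && ~~ (s `<=` f).
Proof.
rewrite !inE fpowersetE andbC; have [fs|//] := boolP (f `<=` s).
by rewrite eqEfsubset fs.
Qed.

Let facet_simplex_bd f t : facet_over n (simplex_bd s) f t -> t `<=` s.
Proof. by case/facet_overP; rewrite in_simplex_bd => /andP[]. Qed.

Lemma normal_simplex_bd : normal_pseudomanifold n (simplex_bd s).
Proof.
split.
- split.
    split.
      by rewrite in_simplex_bd fsub0set fsubset0 -cardfs_eq0 cs.
    move=> f g; rewrite !in_simplex_bd => /andP[fs nsf] gf.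
    rewrite (fsubset_trans gf fs); apply: contra nsf => sg.
    exact: fsubset_trans gf.
  move=> f; rewrite in_simplex_bd => /andP[fs] /(fsubset_fsetD1P fs)[u us fu].
  exists (s `\ u); apply/facet_overP; split=> //; last exact: card_fsetD1.
  by rewrite in_simplex_bd fsubD1set; apply/negP => /fsubsetP/(_ u us); rewrite fsetD11.
- move=> r s1 s2 s3 cr f1 f2 f3.
  have [_ c1 r1] := facet_overP _ _ _ _ f1.
  have [_ c2 r2] := facet_overP _ _ _ _ f2.
  have [_ c3 r3] := facet_overP _ _ _ _ f3.
  apply: (ridge_triple r1 r2 r3 (facet_simplex_bd f1) (facet_simplex_bd f2)
    (facet_simplex_bd f3)); by rewrite ?c1 ?c2 ?c3 ?cr ?cs -?cr.
- move=> f P closedP t t' ft ft' Pt.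
  have [<-//|ntt'] := eqVneq t t'; apply: closedP Pt => //.
  have ts := facet_simplex_bd ft; have t's := facet_simplex_bd ft'.
  have [_ ct _] := facet_overP _ _ _ _ ft; have [_ ct' _] := facet_overP _ _ _ _ ft'.
  (* Two distinct facets together exhaust [s], so they meet in [n - 1] vertices: any two facets are
     adjacent. *)
  have : #|` t `|` t'| <= n.+1 by rewrite -cs fsubset_leq_card // fsubUset ts.
  have : n < #|` t `|` t'|.
    rewrite -{1}ct; apply: fproper_ltn_card; apply: fproperUl; apply: contra ntt' => tt.
    by rewrite eq_sym eqEfcard tt ct ct' /=.
  have := cardfsUI t t'; rewrite ct ct'.
  by move: #|` _| #|` _| => x y; lia.
Qed.

Let facet_simplex f t : f `<=` s -> facet_over n.+1 (simplex s) f t = (t == s).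
Proof.
move=> fs; apply/facet_overP/eqP => [[]|->]; last first.
  by rewrite fpowersetE fsubset_refl cs.
rewrite fpowersetE => ts ct _; apply/eqP; rewrite eqEfcard ts ct cs /=.
exact: leqnn.
Qed.

Let facet_simplexE f t : facet_over n.+1 (simplex s) f t -> t = s.
Proof.
move=> ft; apply/eqP; rewrite -(@facet_simplex f) //.
by case/facet_overP: ft; rewrite fpowersetE => ts _ ft; exact: fsubset_trans ts.
Qed.

Lemma pure_simplex : pure_card n.+1 (simplex s).
Proof.
split.
  split; first by rewrite fpowersetE fsub0set.
  by move=> f g; rewrite !fpowersetE => fs gf; exact: fsubset_trans fs.
by move=> f; rewrite fpowersetE => fs; exists s; rewrite facet_simplex.
Qed.

Lemma thin_simplex : thin n.+1 (simplex s).
Proof. by move=> r s1 s2 s3 _ /facet_simplexE-> /facet_simplexE->; constructor. Qed.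

Lemma connected_simplex : strongly_connected n.+1 (simplex s) fset0.
Proof. by move=> P _ t t' /facet_simplexE-> /facet_simplexE->. Qed.

Lemma boundary_simplex : boundary n%:Z (simplex s) = simplex_bd s.
Proof.
apply/fsetP => f; rewrite in_simplex_bd.
apply/(boundaryP _ pure_simplex)/andP => [[r [t [fr cr /facet_overP[]]]]|[fs]].
  rewrite fpowersetE => ts _ rt _; split.
    by apply: fsubset_trans ts; apply: fsubset_trans rt.
  apply/negP => sf; have : s `<=` r by exact: fsubset_trans fr.
  by move/fsubset_leq_card; rewrite cs cr ltnn.
move/(fsubset_fsetD1P fs) => [u us fu]; exists (s `\ u), s; split=> //.
- exact: card_fsetD1.
- by rewrite facet_simplex // fsubD1set.
- by move=> t /facet_simplexE.
Qed.

End Simplex.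

Lemma shelling_moveE n (a b : face) (Y X : complex) :
  shelling_move n%:Z a b Y X ->
  [/\ pure_card n.+1 Y, X = glue Y (a `|` b) & b != fset0] /\
  [/\ [disjoint a & b]%fset, #|` a `|` b| = n.+1
    & forall f, f `<=` a `|` b -> (f \in Y) = ~~ (b `<=` f)].
Proof.
have dE : (n%:Z = n.+1%:Z - 1)%R by lia.
case=> -[/(pure_cardP _ dE) Yp /(pure_cardP _ dE) Xp /fsubsetP YX].
move=> [aX bX b0 ab] /fsetP fXY /(faces_withinP _ ab) Yab.
have : a `|` b \in facets X `\` facets Y by rewrite fXY fset11.
rewrite in_fsetD (facets_pure _ Xp) => /andP[_ /andP[abX /eqP cab]].
split; split=> //; apply/fsetP => f; rewrite in_glue; apply/idP/orP => [fX|[/YX//|]].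
  have [s /facet_overP[sX cs fs]] := Xp.2 f fX.
  have : (s \in facets X `\` facets Y) = (s == a `|` b) by rewrite fXY inE.
  rewrite in_fsetD (facets_pure _ Xp) (facets_pure _ Yp) sX cs eqxx !andbT /=.
  have [sY _|_ /esym/eqP <-] := boolP (s \in Y); last by right.
  by left; exact: (pure_card_down Yp) fs.
exact: (pure_card_down Xp).
Qed.

Lemma shelling_move_glue n (Y : complex) (a b : face) :
  pure_card n.+1 Y -> b != fset0 -> [disjoint a & b]%fset ->
  #|` a `|` b| = n.+1 ->
  (forall f, f `<=` a `|` b -> (f \in Y) = ~~ (b `<=` f)) ->
  shelling_move n%:Z a b Y (glue Y (a `|` b)).
Proof.
move=> Yp b0 ab cab Yab.
have dE : (n%:Z = n.+1%:Z - 1)%R by lia.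
split.
- split; [exact/(pure_cardP _ dE)|apply/(pure_cardP _ dE)|exact: fsubsetUl].
  exact: glue_pure.
- by rewrite !in_glue fsubsetUl fsubsetUr !orbT.
- exact: (facets_glue Yp).
- exact/faces_withinP.
Qed.

(** * Points of the glued simplex *)

Local Open Scope fset_scope.
Local Open Scope classical_set_scope.
Local Open Scope ring_scope.

Section Geometry.
Variable R : realType.
Implicit Types (x q : nat -> R) (f g s : face).

Lemma geom_simplex_subset f g x : (f `<=` g)%fset ->
  geom_simplex R f x <->
  geom_simplex R g x /\ forall v, v \in g -> v \notin f -> x v = 0.
Proof.
move=> fg.
have sumE : (forall v, v \in g -> v \notin f -> x v = 0) ->
    \sum_(v <- f) x v = \sum_(v <- g) x v.
  by move=> x0; apply: big_fset_incl.
split=> [[x0 xf sx]|[[x0 xg sx] xf]].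
  split; last by move=> v _; exact: xf.
  split=> //; last by rewrite -sumE // => v _; exact: xf.
  by move=> v vg; apply: xf; apply: contra vg; exact: fsubsetP.
split=> //; last by rewrite sumE.
by move=> v vf; have [vg|vg] := boolP (v \in g); [exact: xf|exact: xg].
Qed.

Lemma geom_simplex_le1 f x v : geom_simplex R f x -> x v <= 1.
Proof.
move=> [x0 xf sx]; have [vf|/xf->//] := boolP (v \in f).
by rewrite -sx (big_fsetD1 v) //= lerDl sumr_ge0.
Qed.

Lemma carrierP (X : complex) x :
  carrier R X x <-> exists2 f, f \in X & geom_simplex R f x.
Proof. by split=> -[f]; exists f. Qed.

(* The unit [1] is harmless: coordinates of points of a carrier are at most 1. *)
Definition min_coord s q : R := \big[Num.min/1]_(v <- s) q v.

Lemma le_min_coordE s q t :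
  (t <= min_coord s q) = (t <= 1) && all (fun v => t <= q v) (enum_fset s).
Proof.
rewrite /min_coord; elim: (enum_fset s) => [|v r IH]; first by rewrite big_nil andbT.
by rewrite big_cons le_min IH andbCA.
Qed.

Lemma min_coord_le s q v : v \in s -> min_coord s q <= q v.
Proof.
move=> vs; have := lexx (min_coord s q).
by rewrite le_min_coordE => /andP[_ /allP]; exact.
Qed.

Lemma min_coord_le1 s q : min_coord s q <= 1.
Proof. by have := lexx (min_coord s q); rewrite {1}le_min_coordE => /andP[]. Qed.

Lemma le_min_coord s q t : t <= 1 -> (forall v, v \in s -> t <= q v) ->
  t <= min_coord s q.
Proof. by move=> t1 tq; rewrite le_min_coordE t1; apply/allP. Qed.

Lemma min_coord_attained s q : s != fset0 -> (forall v, q v <= 1) ->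
  exists2 v, v \in s & q v = min_coord s q.
Proof.
move=> /fset0Pn[v0 v0s] q1.
have seq_min (r : seq nat) : \big[Num.min/1]_(v <- r) q v = 1 \/
    exists2 v, v \in r & q v = \big[Num.min/1]_(v <- r) q v.
  elim: r => [|v r [e|[u ur e]]]; first by rewrite big_nil; left.
    rewrite big_cons e; right; exists v; first exact: mem_head.
    exact/esym/min_idPl.
  rewrite big_cons; right; case: (leP (q v) (\big[Num.min/1]_(j <- r) q j)) => _.
    by exists v; rewrite ?mem_head.
  by exists u; rewrite // inE ur orbT.
have [e|//] := seq_min s.
exists v0 => //; apply/eqP; rewrite eq_le min_coord_le // andbT /min_coord e; exact: q1.
Qed.

(** * Moving points across the cap *)

Section Shift.
Variables a b : face.
Hypotheses (a0 : a != fset0) (b0 : b != fset0) (ab : [disjoint a & b]%fset).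

Let na : R := #|` a|%:R.
Let nb : R := #|` b|%:R.

Let na_gt0 : 0 < na. Proof. by rewrite ltr0n cardfs_gt0. Qed.
Let nb_gt0 : 0 < nb. Proof. by rewrite ltr0n cardfs_gt0. Qed.

Let notin_b v : v \in a -> (v \in b) = false.
Proof. by move=> va; apply/negbTE; move/fdisjointP: ab; apply. Qed.

Let notin_a v : v \in b -> (v \in a) = false.
Proof. by move=> vb; apply/negbTE; apply: contraTN vb => /notin_b->. Qed.

(** This is the vector from the barycenter of [a] to that of [b], multiplied by both cardinalities
    to clear denominators. Its coordinates sum to 0. *)
Definition shift_dir v : R := (v \in b)%:R * na - (v \in a)%:R * nb.

Definition shift q t v : R := q v + t * shift_dir v.

Lemma shift_a q t v : v \in a -> shift q t v = q v - t * nb.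
Proof. by move=> va; rewrite /shift /shift_dir notin_b // va /=; ring. Qed.

Lemma shift_b q t v : v \in b -> shift q t v = q v + t * na.
Proof. by move=> vb; rewrite /shift /shift_dir notin_a // vb /=; ring. Qed.

Lemma shift_out q t v : v \notin (a `|` b)%fset -> shift q t v = q v.
Proof.
rewrite inE negb_or => /andP[/negbTE va /negbTE vb].
by rewrite /shift /shift_dir va vb /=; ring.
Qed.

Let sum_dir : \sum_(v <- (a `|` b)%fset) shift_dir v = 0.
Proof.
have sum_ind s : (s `<=` a `|` b)%fset ->
    \sum_(v <- (a `|` b)%fset) (v \in s)%:R = #|` s|%:R :> R.
  move=> sab; rewrite -(big_fset_incl _ sab) /=; last by move=> v _ /negbTE->.
  rewrite (eq_big_seq (fun=> 1)) => [|v ->//].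
  by rewrite big_const_seq count_predT iter_addr_0.
rewrite big_split /= sumrN -!mulr_suml !sum_ind ?fsubsetUl ?fsubsetUr //.
by rewrite mulrC subrr.
Qed.

Lemma shift_simplex q t : geom_simplex R (a `|` b)%fset q -> 0 <= t ->
  (forall v, v \in a -> t * nb <= q v) ->
  geom_simplex R (a `|` b)%fset (shift q t).
Proof.
move=> [q0 qf sq] t0 tq; split.
- move=> v; have [va|nva] := boolP (v \in a); first by rewrite shift_a // subr_ge0 tq.
  have [vb|nvb] := boolP (v \in b).
    by rewrite shift_b // addr_ge0 // mulr_ge0 // ltW.
  by rewrite shift_out ?inE ?negb_or ?nva.
- by move=> v vab; rewrite shift_out // qf.
- by rewrite big_split /= sq -mulr_sumr sum_dir mulr0 addr0.
Qed.

(** Moving [x] backwards until its first [b]-coordinate vanishes leads to the attaching disk. Each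
    [b]-coordinate drops at rate [na], which gives the time [min_coord b x / na]. *)
Lemma unshift x : geom_simplex R (a `|` b)%fset x ->
  exists t q, [/\ 0 <= t, geom_simplex R (a `|` b)%fset q,
    exists2 v, v \in b & q v = 0, x = shift q t
    & forall v, v \in a -> q v = x v + t * nb].
Proof.
move=> gx; have [x0 xf sx] := gx.
have [v0 v0b mv0] := min_coord_attained b0 (fun v => geom_simplex_le1 v gx).
pose t := min_coord b x / na.
have tna : t * na = min_coord b x by rewrite divfK // gt_eqF.
have t0 : 0 <= t by apply: divr_ge0; [rewrite -mv0|exact: ltW].
have xE : x = shift (shift x (- t)) t.
  by apply/funext => v; rewrite /shift; ring.
exists t, (shift x (- t)); split=> //.
- split.
  + move=> v; have [va|nva] := boolP (v \in a).
      by rewrite shift_a // mulNr opprK addr_ge0 // mulr_ge0 // ltW.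
    have [vb|nvb] := boolP (v \in b).
      by rewrite shift_b // mulNr subr_ge0 tna min_coord_le.
    by rewrite shift_out ?inE ?negb_or ?nva.
  + by move=> v vab; rewrite shift_out // xf.
  + by rewrite big_split /= sx -mulr_sumr sum_dir mulr0 addr0.
- by exists v0; rewrite // shift_b // mulNr tna -mv0 subrr.
- by move=> v va; rewrite shift_a // mulNr opprK.
Qed.

Section Complexes.
Variables B X : complex.
Hypotheses (Bd : forall f g, f \in B -> (g `<=` f)%fset -> g \in B).
Hypotheses (Xd : forall f g, f \in X -> (g `<=` f)%fset -> g \in X).
Hypothesis Bab : forall f, (f `<=` a `|` b)%fset -> (f \in B) = ~~ (b `<=` f)%fset.
Hypothesis Xab : forall f, (f `<=` a `|` b)%fset -> (f \in X) = ~~ (b `<=` f)%fset.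
Hypothesis star : forall f, f \in X -> (a `<=` f)%fset -> (f `<=` a `|` b)%fset.

Lemma carrier_star x : carrier R X x -> (forall v, v \in a -> 0 < x v) ->
  geom_simplex R (a `|` b)%fset x /\ exists2 v, v \in b & x v = 0.
Proof.
move=> /carrierP[f fX gx] xa.
have [x0 xf sx] := gx.
have fab : (f `<=` a `|` b)%fset.
  apply: star => //; apply/fsubsetP => v va; apply: contraT => vf.
  by have := xa v va; rewrite xf // ltxx.
split; first by case: ((geom_simplex_subset x fab).1 gx).
by move: fX; rewrite Xab // => /fsubsetPn[v vb vf]; exists v => //; exact: xf.
Qed.

Lemma carrier_opposite x v : geom_simplex R (a `|` b)%fset x -> v \in b ->
  x v = 0 -> carrier R X x.
Proof.
move=> gx vb xv; apply/carrierP; exists ((a `|` b) `\ v)%fset.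
  rewrite Xab ?fsubD1set //; apply/negP => /fsubsetP/(_ v vb).
  by rewrite !inE eqxx.
apply/(geom_simplex_subset x (fsubD1set _ v)); split=> // u uab.
by rewrite !inE negb_and negbK; move: uab; rewrite inE => ->; rewrite orbF => /eqP->.
Qed.

Lemma carrier_positive x : (forall v, v \in b -> 0 < x v) -> ~ carrier R B x.
Proof.
move=> xb /carrierP[f fB [x0 xf sx]].
have bf : (b `<=` f)%fset.
  apply/fsubsetP => v vb; apply: contraT => vf.
  by have := xb v vb; rewrite xf // ltxx.
by have := Bd fB bf; rewrite Bab ?fsubsetUr // fsubset_refl.
Qed.

(** On points, a supporting face not containing [a] means a vanishing [a]-coordinate. *)
Lemma carrier_flip x : carrier R (flip X a b) x <->
  (carrier R X x \/ geom_simplex R (a `|` b)%fset x) /\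
  exists2 v, v \in a & x v = 0.
Proof.
have face_opposite (f : face) v : v \in a -> x v = 0 -> geom_simplex R f x ->
    geom_simplex R (f `\ v)%fset x.
  move=> va xv gx; apply/(geom_simplex_subset x (fsubD1set _ v)); split=> // u uf.
  by rewrite !inE uf andbT negbK => /eqP->.
have a_notin (f : face) v : v \in a -> ~~ (a `<=` f `\ v)%fset.
  by move=> va; apply/negP => /fsubsetP/(_ v va); rewrite !inE eqxx.
split=> [/carrierP[f + gx]|[[/carrierP[f fX gx]|gx] [v va xv]]].
- rewrite in_flip => /andP[/fsubsetPn[v va vf] fXab]; have [_ xf _] := gx.
  split; last by exists v => //; exact: xf.
  case/orP: fXab => [fX|fab]; first by left; apply/carrierP; exists f.
  by right; case: ((geom_simplex_subset x fab).1 gx).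
- apply/carrierP; exists (f `\ v)%fset; last exact: face_opposite.
  by rewrite in_flip a_notin // (Xd fX (fsubD1set _ _)).
- apply/carrierP; exists ((a `|` b) `\ v)%fset; last exact: face_opposite.
  by rewrite in_flip a_notin //= fsubD1set orbT.
Qed.

Lemma carrier_glue x : carrier R (glue B (a `|` b)%fset) x <->
  carrier R B x \/ geom_simplex R (a `|` b)%fset x.
Proof.
split=> [/carrierP[f + gx]|[/carrierP[f fB gx]|gx]].
- rewrite in_glue => /orP[fB|fab]; first by left; apply/carrierP; exists f.
  by right; case: ((geom_simplex_subset x fab).1 gx).
- by apply/carrierP; exists f; rewrite ?in_glue ?fB.
- by apply/carrierP; exists (a `|` b)%fset; rewrite ?in_glue ?fsubset_refl ?orbT.
Qed.

End Complexes.
End Shift.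
End Geometry.

(** * Radial maps *)

Section Euclidean.
Variables (R : realType) (n : nat).
Implicit Types (w : 'rV[R]_n) (f : 'rV[R]_n -> R).

Definition enorm w : R := Num.sqrt (\sum_i w 0 i ^+ 2).

Lemma enorm_ge0 w : 0 <= enorm w. Proof. exact: sqrtr_ge0. Qed.

Let sumsq_ge0 w : 0 <= \sum_i w 0 i ^+ 2.
Proof. by apply: sumr_ge0 => i _; exact: sqr_ge0. Qed.

Lemma unit_ballE w : unit_ball R n w <-> enorm w <= 1.
Proof.
rewrite /unit_ball /=.
suff -> : (enorm w <= 1) = (\sum_i w 0 i ^+ 2 <= 1) by [].
by rewrite /enorm -[X in _ <= X]sqrtr1 ler_sqrt // sqrtr1.
Qed.

Lemma unit_sphereE w : unit_sphere R n w <-> enorm w = 1.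
Proof.
rewrite /unit_sphere /enorm /=; split=> [->|e]; first exact: sqrtr1.
by rewrite -(sqr_sqrtr (sumsq_ge0 w)) e expr1n.
Qed.

Lemma enormZ c w : enorm (c *: w) = `|c| * enorm w.
Proof.
rewrite /enorm -(sqrtr_sqr c) -sqrtrM ?sqr_ge0 // mulr_sumr.
by congr Num.sqrt; apply: eq_bigr => i _; rewrite mxE exprMn.
Qed.

Lemma enorm_eq0 w : enorm w = 0 -> w = 0.
Proof.
move=> e; apply/rowP => i; rewrite mxE; apply/eqP; rewrite -sqrf_eq0.
have : \sum_i w 0 i ^+ 2 = 0 by rewrite -(sqr_sqrtr (sumsq_ge0 w)) -/(enorm w) e expr0n.
by move/eqP; rewrite psumr_eq0 => [/allP/(_ i)|j _]; [apply; rewrite mem_index_enum|exact: sqr_ge0].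
Qed.

Lemma enorm0 : enorm 0 = 0.
Proof. by rewrite -(scale0r 0) enormZ normr0 mul0r. Qed.

Lemma enorm_gt0 w : w != 0 -> 0 < enorm w.
Proof.
move=> w0; rewrite lt_neqAle enorm_ge0 andbT eq_sym; apply: contra w0.
by move=> /eqP/enorm_eq0->.
Qed.

Lemma coord_le_enorm w i : `|w 0 i| <= enorm w.
Proof.
rewrite -sqrtr_sqr ler_sqrt // (bigD1 i) //= lerDl.
by apply: sumr_ge0 => j _; exact: sqr_ge0.
Qed.

Lemma norm_le_enorm w : `|w| <= enorm w.
Proof.
rewrite -[leLHS]/(mx_norm w) mx_normrE; apply/bigmax_leP; split=> [|[i j] _ /=].
  exact: enorm_ge0.
by rewrite ord1; exact: coord_le_enorm.
Qed.

(** With the convention that 0 has inverse 0, [dir 0] is the center, so [dir w] lies in the unit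
    ball for every [w]. *)
Definition dir w := (enorm w)^-1 *: w.

Lemma enorm_dir w : w != 0 -> enorm (dir w) = 1.
Proof.
move=> /enorm_gt0 w0; rewrite enormZ ger0_norm ?invr_ge0 ?enorm_ge0 //.
by rewrite mulVf // gt_eqF.
Qed.

Lemma dir0 : dir 0 = 0. Proof. exact: scaler0. Qed.

Lemma dirE w : w = enorm w *: dir w.
Proof.
have [->|w0] := eqVneq w 0; first by rewrite dir0 scaler0.
by rewrite /dir scalerA mulfV ?scale1r // gt_eqF // enorm_gt0.
Qed.

Lemma dirZ c w : 0 < c -> dir (c *: w) = dir w.
Proof.
move=> c0; rewrite /dir enormZ gtr0_norm // scalerA invfM mulrAC mulVf ?mul1r //.
exact: lt0r_neq0.
Qed.

Lemma dir_sphere w : enorm w = 1 -> dir w = w.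
Proof. by move=> e; rewrite /dir e invr1 scale1r. Qed.

Lemma dir_ball w : unit_ball R n (dir w).
Proof.
apply/unit_ballE; have [->|/enorm_dir->//] := eqVneq w 0.
by rewrite dir0 enorm0.
Qed.

Lemma continuous_sum (I : Type) (r : seq I) (F : I -> 'rV[R]_n -> R) w :
  (forall i, continuous_at w (F i)) ->
  continuous_at w (fun z => \sum_(i <- r) F i z).
Proof.
move=> cF; elim: r => [|i r IH].
  rewrite (_ : (fun _ => _) = fun=> 0); first exact: cst_continuous.
    by apply/funext => z; rewrite big_nil.
rewrite (_ : (fun _ => _) = (fun z => F i z + \sum_(i <- r) F i z)).
  exact: cvgD (cF i) IH.
by apply/funext => z; rewrite big_cons.
Qed.

Lemma continuous_max f g w : continuous_at w f -> continuous_at w g ->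
  continuous_at w (fun z => Num.max (f z) (g z)).
Proof.
move=> cf cg; rewrite (_ : (fun _ => _) = (fun z => (f z + g z + `|f z - g z|) / 2)); last first.
  by apply/funext => z; rewrite maxr_absE.
exact: (cvgM (cvgD (cvgD cf cg) (cvg_norm (cvgB cf cg))) (cvg_cst _)).
Qed.

Lemma continuous_min f g w : continuous_at w f -> continuous_at w g ->
  continuous_at w (fun z => Num.min (f z) (g z)).
Proof.
move=> cf cg; rewrite (_ : (fun _ => _) = (fun z => (f z + g z - `|f z - g z|) / 2)); last first.
  by apply/funext => z; rewrite minr_absE.
exact: (cvgM (cvgB (cvgD cf cg) (cvg_norm (cvgB cf cg))) (cvg_cst _)).
Qed.

Lemma enorm_continuous : continuous enorm.
Proof.
move=> w; apply: (@continuous_comp _ _ _ (fun w => \sum_i w 0 i ^+ 2) Num.sqrt).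
  apply: continuous_sum => i.
  have ci := @coord_continuous R 1 n 0 i w.
  exact: (cvgM ci ci).
exact: sqrt_continuous.
Qed.

Lemma dir_continuous w : w != 0 -> continuous_at w dir.
Proof.
move=> w0; have w1 : enorm w != 0 by rewrite gt_eqF // enorm_gt0.
exact: (cvgZ (cvgV w1 (@enorm_continuous w)) cvg_id).
Qed.

(** A function depending on the direction may jump at the origin; being bounded, it is squeezed to 0
    there by the factor [enorm w]. *)
Lemma radial_continuous f (M : R) : (forall w, `|f w| <= M) ->
  (forall w, w != 0 -> continuous_at w f) ->
  continuous (fun w => enorm w * f w).
Proof.
move=> fM cf w; have [->|w0] := eqVneq w 0; last first.
  exact: (cvgM (@enorm_continuous w) (cf w w0)).
rewrite /continuous_at enorm0 mul0r; apply/norm_cvg0P; first exact: nbhs_filter.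
have bound : M * enorm z @[z --> (0 : 'rV[R]_n)] --> (0 : R).
  by rewrite -[X in _ --> X](mulr0 M) -enorm0; exact: (cvgM (cvg_cst M) (@enorm_continuous 0)).
apply: (squeeze_cvgr _ (cvg_cst 0) bound).
near=> z; rewrite normr_ge0 normrM (ger0_norm (enorm_ge0 _)) mulrC.
by rewrite ler_wpM2r // enorm_ge0.
Unshelve. all: by end_near. Qed.

Lemma scaling_continuous f (M : R) : (forall w, `|f w| <= M) ->
  (forall w, w != 0 -> continuous_at w f) ->
  continuous (fun w => f w *: w).
Proof.
move=> fM cf w; have [->|w0] := eqVneq w 0; last first.
  exact: (cvgZ (cf w w0) cvg_id).
rewrite /continuous_at scaler0; apply/norm_cvg0P; first exact: nbhs_filter.
have bound : M * enorm z @[z --> (0 : 'rV[R]_n)] --> (0 : R).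
  by rewrite -[X in _ --> X](mulr0 M) -enorm0; exact: (cvgM (cvg_cst M) (@enorm_continuous 0)).
apply: (squeeze_cvgr _ (cvg_cst 0) bound).
near=> z; rewrite normr_ge0 normrZ /=.
by apply: ler_pM => //; exact: norm_le_enorm.
Unshelve. all: by end_near. Qed.

Lemma unit_ball_compact : compact (unit_ball R n).
Proof.
apply: bounded_closed_compact.
  exists 1; split=> // M M1 w /unit_ballE w1.
  by apply: le_trans (norm_le_enorm w) _; apply: le_trans w1 _; exact: ltW.
have -> : unit_ball R n = enorm @^-1` [set t | t <= 1].
  by apply/funext => w; apply/propext; exact: unit_ballE.
apply: closed_comp; last exact: closed_le.
by move=> w _; exact: enorm_continuous.
Qed.

End Euclidean.

(** * Parametrizations by the unit ball *)

Section Parametrization.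
Variables (R : realType) (n : nat).
Implicit Types (w : 'rV[R]_n) (G : 'rV[R]_n -> nat -> R).

(* [G] restricts to a homeomorphism of pairs from (ball, sphere) onto
   (carrier of [B], carrier of [X]); by compactness, continuity of the inverse
   need not be asked for. *)
Definition parametrizes G (B X : complex) :=
  [/\ forall v, continuous (fun w => G w v),
      forall w w', unit_ball R n w -> unit_ball R n w' -> G w = G w' -> w = w',
      forall x, carrier R B x <-> exists2 w, unit_ball R n w & G w = x
    & forall x, carrier R X x <-> exists2 w, unit_sphere R n w & G w = x].

Section Glue.
Variables (B X : complex) (a b : face) (G0 : 'rV[R]_n -> nat -> R).
Hypothesis G0P : parametrizes G0 B X.
Hypotheses (a0 : a != fset0) (b0 : b != fset0) (ab : [disjoint a & b]%fset).
Hypotheses (Bd : forall f g : face, f \in B -> (g `<=` f)%fset -> g \in B).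
Hypotheses (Xd : forall f g : face, f \in X -> (g `<=` f)%fset -> g \in X).
Hypothesis Bab : forall f : face,
  (f `<=` a `|` b)%fset -> (f \in B) = ~~ (b `<=` f)%fset.
Hypothesis Xab : forall f : face,
  (f `<=` a `|` b)%fset -> (f \in X) = ~~ (b `<=` f)%fset.
Hypothesis star : forall f : face,
  f \in X -> (a `<=` f)%fset -> (f `<=` a `|` b)%fset.

Let nb : R := #|` b|%:R.
Let nb_gt0 : 0 < nb. Proof. by rewrite ltr0n cardfs_gt0. Qed.
Let nb_ge1 : 1 <= nb. Proof. by rewrite ler1n cardfs_gt0. Qed.

(* The cap over the point [G0 (dir w)] of the sphere has height [height w]. *)
Let height w : R := min_coord a (G0 (dir w)) / nb.
(** The vector [(1 + height w) *: w] has norm [radius w], so the unit sphere is pushed out to radius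
    [1 + height w]. The part up to radius 1 is mapped by [G0] onto the old ball; beyond it, [shrink]
    stops the argument at the unit sphere and [excess] is the time spent moving across the cap. The
    maxima merge both cases into one continuous formula. *)
Let radius w : R := enorm w * (1 + height w).
Let shrink w : R := (1 + height w) / Num.max 1 (radius w).
Let excess w : R := Num.max (radius w - 1) 0.
Let G w : nat -> R := shift a b (G0 (shrink w *: w)) (excess w).

Let q_ge0 w v : 0 <= G0 (dir w) v.
Proof.
have [_ _ GB _] := G0P.
have /carrierP[f _ [x0 _ _]] : carrier R B (G0 (dir w)).
  by apply/GB; exists (dir w) => //; exact: dir_ball.
exact: x0.
Qed.

Let height_ge0 w : 0 <= height w.
Proof. by apply: divr_ge0; [apply: le_min_coord|exact: ltW]. Qed.

Let height_le1 w : height w <= 1.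
Proof. by rewrite ler_pdivrMr // mul1r (le_trans (min_coord_le1 _ _)). Qed.

Let dir_carrier w : w != 0 -> carrier R X (G0 (dir w)).
Proof.
have [_ _ _ GX] := G0P => w0; apply/GX; exists (dir w) => //.
by apply/unit_sphereE/enorm_dir.
Qed.

Let height_pos w : w != 0 -> 0 < height w ->
  geom_simplex R (a `|` b)%fset (G0 (dir w)) /\
  exists2 v, v \in b & G0 (dir w) v = 0.
Proof.
move=> w0 h0; apply: (carrier_star Xab star (dir_carrier w0)) => v va.
have m0 : 0 < min_coord a (G0 (dir w)) by move: h0; rewrite pmulr_lgt0 // invr_gt0.
exact: lt_le_trans m0 (min_coord_le _ va).
Qed.

Let one_height_gt0 w : 0 < 1 + height w.
Proof. by rewrite ltr_wpDr. Qed.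

Let G_in w : radius w <= 1 -> G w = G0 ((1 + height w) *: w).
Proof.
move=> r1; rewrite /G /shrink /excess max_l // divr1 max_r ?subr_le0 //.
by apply/funext => v; rewrite /shift mul0r addr0.
Qed.

Let G_out w : 1 < radius w ->
  w != 0 /\ G w = shift a b (G0 (dir w)) (radius w - 1).
Proof.
move=> r1; have w0 : w != 0.
  by apply: contraTneq r1 => ->; rewrite /radius enorm0 mul0r -leNgt.
split=> //; rewrite /G /shrink /excess max_r ?(ltW r1) // max_l ?subr_ge0 ?(ltW r1) //.
congr (shift a b (G0 _) _); rewrite /dir /radius invfM mulrCA mulfV ?mulr1 //.
exact: lt0r_neq0.
Qed.

Let out_le w : unit_ball R n w -> radius w - 1 <= height w.
Proof.
move=> /unit_ballE w1; rewrite lerBlDl -[leRHS]mul1r.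
by rewrite ler_wpM2r // ltW.
Qed.

Let G_out_shift w : unit_ball R n w -> 1 < radius w ->
  [/\ geom_simplex R (a `|` b)%fset (G0 (dir w)),
      exists2 v, v \in b & G0 (dir w) v = 0
    & forall v, v \in a -> (radius w - 1) * nb <= G0 (dir w) v].
Proof.
move=> w1 r1; have [w0 _] := G_out r1; have tle := out_le w1.
have h0 : 0 < height w by apply: lt_le_trans tle; rewrite subr_gt0.
have [gq qb] := height_pos w0 h0; split=> // v va.
by apply: le_trans (min_coord_le _ va); rewrite -ler_pdivlMr.
Qed.

Let radius_enorm w : radius w = enorm ((1 + height w) *: w).
Proof. by rewrite enormZ gtr0_norm // mulrC. Qed.

Let in_ball w : radius w <= 1 -> unit_ball R n ((1 + height w) *: w).
Proof. by move=> r1; apply/unit_ballE; rewrite -radius_enorm. Qed.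

Let G_out_notin w : unit_ball R n w -> 1 < radius w -> ~ carrier R B (G w).
Proof.
move=> w1 r1; have [w0 ->] := G_out r1; have [[q0 _ _] _ _] := G_out_shift w1 r1.
apply: (carrier_positive Bd Bab) => v vb; rewrite shift_b //.
by rewrite ltr_wpDl // mulr_gt0 ?subr_gt0 // ltr0n cardfs_gt0.
Qed.

Let G_in_carrier w : radius w <= 1 -> carrier R B (G w).
Proof.
have [_ _ GB _] := G0P => r1; rewrite G_in //; apply/GB.
by exists ((1 + height w) *: w) => //; exact: in_ball.
Qed.

Let G_inj w w' : unit_ball R n w -> unit_ball R n w' -> G w = G w' -> w = w'.
Proof.
have [_ G0inj _ _] := G0P => w1 w1' e.
have [r1|r1] := leP (radius w) 1; have [r1'|r1'] := leP (radius w') 1.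
- move: e; rewrite !G_in // => /(G0inj _ _ (in_ball r1) (in_ball r1')) e.
  have ed : dir w = dir w'.
    by rewrite -(@dirZ _ _ (1 + height w)) // e dirZ.
  move: e; rewrite /height ed => /scalerI; apply.
  exact: lt0r_neq0 (one_height_gt0 w').
- by case: (G_out_notin w1' r1'); rewrite -e; exact: G_in_carrier.
- by case: (G_out_notin w1 r1); rewrite e; exact: G_in_carrier.
have [w0 eG] := G_out r1; have [w0' eG'] := G_out r1'.
have [_ [v vb qv] _] := G_out_shift w1 r1; have [_ [v' vb' qv'] _] := G_out_shift w1' r1'.
move: e; rewrite eG eG' => /funeqP e.
have na0 : 0 < #|` a|%:R :> R by rewrite ltr0n cardfs_gt0.
(* Each of the two base points has a vanishing [b]-coordinate; comparing the images there bounds one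
   time by the other, in both directions. *)
have t_eq : radius w - 1 = radius w' - 1.
  have := e v; have := e v'; rewrite !shift_b // qv qv' !add0r => e1 e2.
  apply/eqP; rewrite eq_le -(ler_pM2r na0) -[X in _ && X](ler_pM2r na0).
  by rewrite -e1 lerDr q_ge0 e1 e2 lerDr q_ge0.
have ed : dir w = dir w'.
  apply: G0inj; try exact: dir_ball.
  apply/funext => u; have := e u; rewrite /shift t_eq; exact: addIr.
have eh : height w = height w' by rewrite /height ed.
move: t_eq => /addIr; rewrite /radius eh => /mulIf en.
by rewrite (dirE w) (dirE w') ed en //; exact: lt0r_neq0.
Qed.

Let preimage_in x : carrier R B x -> exists2 w, unit_ball R n w & G w = x.
Proof.
have [_ _ GB _] := G0P => /GB[z z1 <-].
(* The height depends on the direction only, so the rescaling is undone by dividing by the factor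
   computed at [z]. *)
pose w := (1 + min_coord a (G0 (dir z)) / nb)^-1 *: z.
have hw : height w = min_coord a (G0 (dir z)) / nb.
  rewrite /height dirZ // invr_gt0; exact: (one_height_gt0 z).
have wE : (1 + height w) *: w = z.
  by rewrite hw scalerA mulfV ?scale1r //; exact: lt0r_neq0 (one_height_gt0 z).
have rw : radius w <= 1 by rewrite radius_enorm wE; apply/unit_ballE.
exists w; last by rewrite G_in // wE.
apply/unit_ballE; apply: le_trans rw; rewrite -[leLHS]mulr1.
by rewrite ler_wpM2l ?enorm_ge0 // lerDl.
Qed.

Let preimage_out x : geom_simplex R (a `|` b)%fset x ->
  exists w, [/\ unit_ball R n w, G w = x &
    (exists2 v, v \in a & x v = 0) -> unit_sphere R n w].
Proof.
have [_ _ _ GX] := G0P => gx.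
have [t [q [t0 gq [v0 v0b qv0] xE qa]]] := unshift a0 b0 ab gx.
have /GX[z /unit_sphereE z1 Gz] := carrier_opposite Xab gq v0b qv0.
have zd := dir_sphere z1.
have z0 : z != 0.
  by apply: contraTneq isT => z0; move: z1; rewrite z0 enorm0 => /esym/eqP; rewrite oner_eq0.
have hz : height z = min_coord a q / nb by rewrite /height zd Gz.
have [x0 _ _] := gx.
(* The [a]-coordinates of [x] are nonnegative, so [q] exceeds [t * nb] on all of [a]; the bound by 1
   built into [min_coord] follows from any single vertex of [a]. *)
have th : t <= height z.
  rewrite hz ler_pdivlMr //; apply: le_min_coord => [|v va]; last by rewrite qa // lerDr.
  have /fset0Pn[v va] := a0.
  by apply: le_trans (geom_simplex_le1 v gq); rewrite qa // lerDr.
(* Chosen so that [c *: z] has radius [1 + t], that is, excess [t] over the base point [q]. *)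
pose c := (1 + t) / (1 + height z).
have c0 : 0 < c by rewrite divr_gt0 // ltr_wpDr.
have hw : height (c *: z) = height z by rewrite /height dirZ.
have ew : enorm (c *: z) = c by rewrite enormZ z1 mulr1 gtr0_norm.
have rw : radius (c *: z) = 1 + t.
  by rewrite /radius ew hw divfK //; exact: lt0r_neq0.
exists (c *: z); split.
- by apply/unit_ballE; rewrite ew ler_pdivrMr // mul1r lerD2l.
(* Radius at most 1 means [t = 0], where the two formulas for [G] agree. *)
- have [r1|r1] := leP (radius (c *: z)) 1.
    have tz : t = 0 by apply/eqP; rewrite eq_le t0 andbT; move: r1; rewrite rw gerDl.
    rewrite G_in // hw scalerA /c mulrC divfK ?tz ?addr0 ?scale1r; last exact: lt0r_neq0.
    by rewrite Gz xE tz; apply/funext => v; rewrite /shift mul0r addr0.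
  have [_ ->] := G_out r1.
  by rewrite dirZ // zd Gz rw xE; congr shift; ring.
move=> [v va xv]; apply/unit_sphereE; rewrite ew /c.
suff -> : height z = t by rewrite mulfV //; apply: lt0r_neq0; rewrite ltr_wpDr.
apply/eqP; rewrite eq_le th andbT hz ler_pdivrMr //.
by apply: le_trans (min_coord_le _ va) _; rewrite qa // xv add0r.
Qed.

(** The height is controlled only away from the origin, but it enters through products with
    [enorm w] or [w]; the bound 2 on [1 + height w] makes these continuous at the origin too. *)
Let G_continuous v : continuous (fun w => G w v).
Proof.
have [Gc _ _ _] := G0P.
have height_cont w : w != 0 -> continuous_at w height.
  move=> w0.
  have mc (s : seq nat) :
      continuous_at w (fun z => \big[Num.min/1]_(u <- s) G0 (dir z) u).
    elim: s => [|u s IH].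
      rewrite (_ : (fun _ => _) = fun=> 1); first exact: cst_continuous.
      by apply/funext => z; rewrite big_nil.
    rewrite (_ : (fun _ => _) =
      fun z => Num.min (G0 (dir z) u) (\big[Num.min/1]_(u <- s) G0 (dir z) u)).
      apply: continuous_min IH.
      exact: (continuous_comp (dir_continuous w0) (Gc u (dir w))).
    by apply/funext => z; rewrite big_cons.
  exact: (cvgM (mc _) (cvg_cst _)).
have one_height_cont w : w != 0 -> continuous_at w (fun z => 1 + height z).
  move=> w0; have h1 : continuous_at w (fun=> 1 : R) by exact: cst_continuous.
  exact: (cvgD h1 (height_cont w w0)).
have one_height_le w : `|1 + height w| <= 2.
  by rewrite gtr0_norm //; have := height_le1 w; lra.
have radius_cont : continuous radius by exact: radial_continuous one_height_le _.
have max_cont w : continuous_at w (fun z => Num.max 1 (radius z)).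
  by apply: continuous_max; [exact: cst_continuous|exact: radius_cont].
have max_gt0 w : 0 < Num.max 1 (radius w) by rewrite lt_max ltr01.
have shrink_cont w : w != 0 -> continuous_at w shrink.
  move=> w0; have m0 := lt0r_neq0 (max_gt0 w).
  exact: (cvgM (one_height_cont w w0) (cvgV m0 (max_cont w))).
have shrink_le w : `|shrink w| <= 2.
  rewrite normrM normfV (gtr0_norm (max_gt0 w)) ler_pdivrMr //.
  apply: le_trans (one_height_le w) _; rewrite ler_peMr //.
  by rewrite le_max lexx.
have arg_cont := scaling_continuous shrink_le shrink_cont.
have excess_cont w : continuous_at w excess.
  apply: continuous_max; last exact: cst_continuous.
  have h1 : continuous_at w (fun=> 1 : R) by exact: cst_continuous.
  exact: (cvgB (radius_cont w) h1).
move=> w.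
exact: (cvgD (continuous_comp (arg_cont w) (Gc v _))
  (cvgM (excess_cont w) (cvg_cst (shift_dir R a b v)))).
Qed.

Lemma parametrizes_glue :
  exists G1, parametrizes G1 (glue B (a `|` b)%fset) (flip X a b).
Proof.
have [_ _ GB GX] := G0P; exists G; split.
- exact: G_continuous.
- exact: G_inj.
- move=> x; rewrite carrier_glue; split=> [[/preimage_in//|gx]|[w w1 <-]].
    by have [w [w1 Gw _]] := preimage_out gx; exists w.
  have [r1|r1] := leP (radius w) 1; [left; exact: G_in_carrier|right].
  have [_ ->] := G_out r1; have [gq _ qa] := G_out_shift w1 r1.
  by apply: shift_simplex => //; rewrite subr_ge0 ltW.
move=> x; rewrite carrier_flip //; split=> [[[Xx|gx] [v va xv]]|[w /unit_sphereE w1 <-]].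
- have /GX[w w1 Gw] := Xx; exists w => //.
  have wd := dir_sphere ((unit_sphereE w).1 w1).
  (* A point of the old sphere with a vanishing [a]-coordinate carries a cap of height 0 and stays
     in place. *)
  have hw : height w = 0.
    apply/eqP; rewrite eq_le height_ge0 andbT /height wd Gw ler_pdivrMr // mul0r -xv.
    exact: min_coord_le.
  have rw : radius w = 1.
    by rewrite /radius hw addr0 mulr1; apply/unit_sphereE.
  by rewrite G_in ?rw // hw addr0 scale1r.
- by have [w [_ Gw w1]] := preimage_out gx; exists w => //; apply: w1; exists v.
have wb : unit_ball R n w by apply/unit_ballE; rewrite w1.
(* Over the unit sphere the base point moves for the full height, the time at which its smallest
   [a]-coordinate reaches 0. *)
have rw : radius w = 1 + height w by rewrite /radius w1 mul1r.
have w0 : w != 0.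
  by apply: contraTneq isT => w0; move: w1; rewrite w0 enorm0 => /esym/eqP; rewrite oner_eq0.
have Xq := dir_carrier w0; have wd := dir_sphere w1.
have q1 v : G0 (dir w) v <= 1.
  by move: Xq => /carrierP[f _]; exact: geom_simplex_le1.
have [v va qv] := min_coord_attained a0 q1.
have [r1|r1] := leP (radius w) 1.
  have hw : height w = 0 by apply/eqP; rewrite eq_le height_ge0 andbT; move: r1; rewrite rw gerDl.
  rewrite G_in // hw addr0 scale1r; rewrite wd in Xq qv; split; first by left.
  exists v => //; rewrite qv; move: hw => /eqP; rewrite /height mulf_eq0 invr_eq0 wd.
  by rewrite (gt_eqF nb_gt0) orbF => /eqP.
have [_ ->] := G_out r1; have [gq _ qa] := G_out_shift wb r1; split.
  by right; apply: shift_simplex => //; rewrite subr_ge0 ltW.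
exists v => //; rewrite shift_a // rw addrAC subrr add0r qv divfK ?subrr //.
exact: lt0r_neq0.
Qed.

End Glue.
End Parametrization.

(** * Parametrization of a simplex by the Euclidean ball *)

Section StandardBall.
Variables (R : realType) (n : nat) (s : face) (v0 : nat).
Hypotheses (cs : #|` s| = n.+1) (v0s : v0 \in s).
Implicit Types (w : 'rV[R]_n).

Let s' : face := (s `\ v0)%fset.
Let cs' : size (enum_fset s') = n. Proof. exact: card_fsetD1. Qed.

(* Coordinates, relative to the barycenter of [s], of the image of [w] under a
   linear isomorphism onto the directions of the hyperplane spanned by [s]. *)
Let z w v : R :=
  if v == v0 then - \sum_i w 0 i
  else if insub (index v s') is Some i then w 0 i else 0.

Let vertex (i : 'I_n) : nat := nth 0%N s' i.

Let vertex_in i : vertex i \in s'.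
Proof. by apply: mem_nth; rewrite cs'. Qed.

Let z_vertex w i : z w (vertex i) = w 0 i.
Proof.
rewrite /z; case: eqP => [e|_].
  by have := vertex_in i; rewrite e /s' fsetD11.
rewrite /vertex index_uniq ?cs' ?fset_uniq //.
by case: insubP => [j _ /val_inj->//|]; rewrite ltn_ord.
Qed.

Let z_out w v : v \notin s -> z w v = 0.
Proof.
move=> vs; rewrite /z; case: eqP => [e|_]; first by rewrite e v0s in vs.
have nv : ~~ (index v s' < n)%N.
  rewrite -cs' index_mem; apply: contra vs; exact: (fsubsetP (fsubD1set s v0)).
by case: insubP => // i iv; rewrite iv in nv.
Qed.

Let sum_vertices (F : nat -> R) :
  \sum_(v <- s) F v = F v0 + \sum_(i < n) F (vertex i).
Proof.
rewrite (big_fsetD1 v0) //=; congr (_ + _).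
by rewrite (big_nth 0%N) cs' big_mkord.
Qed.

Let z_sum w : \sum_(v <- s) z w v = 0.
Proof.
have z0 : z w v0 = - \sum_i w 0 i by rewrite /z eqxx.
by rewrite sum_vertices z0 (eq_bigr _ (fun i _ => z_vertex w i)) addNr.
Qed.

Let zZ c w v : z (c *: w) v = c * z w v.
Proof.
rewrite /z; case: eqP => _.
  by rewrite mulrN mulr_sumr; congr (- _); apply: eq_bigr => i _; rewrite mxE.
by case: insub => [i|]; rewrite ?mxE ?mulr0.
Qed.

Let z_continuous v : continuous (fun w => z w v).
Proof.
move=> w; have ci := fun i => @coord_continuous R 1 n 0 i w.
rewrite /z; case: eqP => _; last first.
  by case: insub => [i|]; [exact: ci|exact: cst_continuous].
exact: (cvgN (continuous_sum ci)).
Qed.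

Let z_eq0 w : (forall v, z w v = 0) -> w = 0.
Proof. by move=> w0; apply/rowP => i; rewrite mxE -z_vertex. Qed.

Let m : R := n.+1%:R.
Let m_gt0 : 0 < m. Proof. exact: ltr0Sn. Qed.
Let m_ge1 : 1 <= m. Proof. by rewrite ler1n. Qed.

(** The Minkowski gauge of the simplex about its barycenter: the coordinate [1 / m + z w v] is
    nonnegative exactly when [- (m * z w v) <= 1]. The initial 0 does not change the maximum, since
    the [z w v] sum to 0. *)
Let gauge w : R := \big[Num.max/0]_(v <- s) - (m * z w v).

Let gauge_leE w t :
  (gauge w <= t) = (0 <= t) && all (fun v => - (m * z w v) <= t) (enum_fset s).
Proof.
rewrite /gauge; elim: (enum_fset s) => [|v r IH]; first by rewrite big_nil andbT.
by rewrite big_cons ge_max IH andbCA.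
Qed.

Let gauge_ge0 w : 0 <= gauge w.
Proof. by have := lexx (gauge w); rewrite {1}gauge_leE => /andP[]. Qed.

Let gauge_ge w v : v \in s -> - (m * z w v) <= gauge w.
Proof.
move=> vs; have := lexx (gauge w).
by rewrite {1}gauge_leE => /andP[_ /allP]; exact.
Qed.

Let gauge_attained w : gauge w = 0 \/
  exists2 v, v \in s & gauge w = - (m * z w v).
Proof.
suff seq_max (r : seq nat) : let g := \big[Num.max/0]_(v <- r) - (m * z w v) in
    g = 0 \/ exists2 v, v \in r & g = - (m * z w v) by exact: seq_max.
elim: r => [|v r IH]; first by rewrite /= big_nil; left.
rewrite /= big_cons; case: leP => _; last by right; exists v; rewrite ?mem_head.
case: IH => [->|[u ur ->]]; first by left.
by right; exists u; rewrite // inE ur orbT.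
Qed.

Let gaugeZ c w : 0 <= c -> gauge (c *: w) = c * gauge w.
Proof.
move=> c0; rewrite /gauge; elim: (enum_fset s) => [|v r IH].
  by rewrite !big_nil mulr0.
by rewrite !big_cons IH zZ maxr_pMr // mulrN mulrCA.
Qed.

Let gauge_gt0 w : w != 0 -> 0 < gauge w.
Proof.
rewrite lt_neqAle gauge_ge0 andbT; apply: contra => /eqP g0; apply/eqP/z_eq0 => v.
have z0 u : u \in s -> 0 <= z w u.
  by move=> us; have := gauge_ge w us; rewrite -g0 oppr_le0 pmulr_rge0.
have [vs|/z_out->//] := boolP (v \in s).
have := z_sum w; rewrite (big_fsetD1 v) //= => /eqP.
rewrite paddr_eq0 ?z0 // => [/andP[/eqP//]|].
by rewrite big_seq sumr_ge0 // => u /(fsubsetP (fsubD1set s v))/z0.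
Qed.

Let gauge_continuous : continuous gauge.
Proof.
move=> w; rewrite /gauge; elim: (enum_fset s) => [|v r IH].
  rewrite (_ : (fun _ => _) = fun=> 0); first exact: cst_continuous.
  by apply/funext => y; rewrite big_nil.
rewrite (_ : (fun _ => _) = fun y =>
    Num.max (- (m * z y v)) (\big[Num.max/0]_(u <- r) - (m * z y u))).
  apply: continuous_max IH.
  exact: (cvgN (cvgM (cvg_cst m) (@z_continuous v w))).
by apply/funext => y; rewrite big_cons.
Qed.

Let point w v : R := (v \in s)%:R / m + z w v.

Let point_in w v : v \in s -> point w v = (1 + m * z w v) / m.
Proof. by move=> vs; rewrite /point vs mulrDl mulrAC mulfV ?mul1r // lt0r_neq0. Qed.

Let point_sum w : \sum_(v <- s) point w v = 1.
Proof.
rewrite big_split /= z_sum addr0 -mulr_suml (eq_big_seq (fun=> 1)) => [|v ->//].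
by rewrite big_const_seq count_predT iter_addr_0 cs mulfV // lt0r_neq0.
Qed.

Let point_simplex w : geom_simplex R s (point w) <-> gauge w <= 1.
Proof.
split=> [[x0 _ _]|g1].
  rewrite gauge_leE ler01 /=; apply/allP => v vs; have := x0 v.
  by rewrite point_in // pmulr_lge0 ?invr_gt0 //; lra.
split; last exact: point_sum.
- move=> v; have [vs|vs] := boolP (v \in s).
    rewrite point_in // divr_ge0 ?(ltW m_gt0) //.
    by have := le_trans (gauge_ge w vs) g1; lra.
  by rewrite /point (negbTE vs) mul0r add0r z_out.
- by move=> v vs; rewrite /point (negbTE vs) mul0r add0r z_out.
Qed.

Let point_bd w : gauge w <= 1 ->
  (exists2 v, v \in s & point w v = 0) <-> gauge w = 1.
Proof.
move=> g1; split=> [[v vs]|ge].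
  rewrite point_in // => /eqP; rewrite mulf_eq0 invr_eq0 (gt_eqF m_gt0) orbF => /eqP e.
  by apply/eqP; rewrite eq_le g1 /=; apply: le_trans (gauge_ge w vs); lra.
have [g0|[v vs gv]] := gauge_attained w.
  by move: ge; rewrite g0 => /esym/eqP; rewrite oner_eq0.
by exists v => //; rewrite point_in // (_ : 1 + m * z w v = 0) ?mul0r //; lra.
Qed.

Let point_surj x : geom_simplex R s x -> exists w, point w = x.
Proof.
move=> [x0 xs sx]; pose w : 'rV[R]_n := \row_i (x (vertex i) - m^-1).
have wE i : point w (vertex i) = x (vertex i).
  have vs := fsubsetP (fsubD1set s v0) _ (vertex_in i).
  by rewrite /point vs z_vertex mxE mul1r addrC subrK.
exists w; apply/funext => v; have [vs|vs] := boolP (v \in s); last first.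
  by rewrite xs // /point (negbTE vs) mul0r add0r z_out.
have [->|vv0] := eqVneq v v0.
  have := point_sum w; rewrite -sx !sum_vertices.
  by rewrite (eq_bigr _ (fun i _ => wE i)); exact: addIr.
have vs' : v \in s' by rewrite !inE vv0.
have iv : (index v s' < n)%N by rewrite -cs' index_mem.
by have := wE (Ordinal iv); rewrite /vertex /= nth_index.
Qed.

Let point_inj w w' : point w = point w' -> w = w'.
Proof.
move=> e; apply/rowP => i; rewrite -!z_vertex.
by have /funeqP/(_ (vertex i)) := e; rewrite /point => /addrI.
Qed.

(** The radial map that turns the Euclidean norm into the gauge, hence the ball into the simplex and
    the sphere into its boundary. *)
Let rescale w := (enorm w / gauge w) *: w.

Let gauge_rescale w : gauge (rescale w) = enorm w.
Proof.
rewrite gaugeZ ?divr_ge0 ?enorm_ge0 //.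
have [->|w0] := eqVneq w 0; first by rewrite enorm0 !mul0r.
by rewrite divfK // lt0r_neq0 // gauge_gt0.
Qed.

Let rescale_inj w w' : rescale w = rescale w' -> w = w'.
Proof.
move=> e; have en : enorm w = enorm w' by rewrite -!gauge_rescale e.
have [w0|w0] := eqVneq w 0.
  by move: en; rewrite w0 enorm0 => /esym/enorm_eq0.
have w0' : w' != 0.
  by apply: contra w0 => /eqP w0'; apply/eqP/enorm_eq0; rewrite en w0' enorm0.
rewrite (dirE w) (dirE w') en; congr (_ *: _).
have pos u : u != 0 -> 0 < enorm u / gauge u.
  by move=> u0; rewrite divr_gt0 ?enorm_gt0 ?gauge_gt0.
by rewrite -(dirZ w (pos w w0)) -(dirZ w' (pos w' w0')) -/(rescale w) e.
Qed.

Let rescale_surj w : exists w', rescale w' = w.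
Proof.
have [->|w0] := eqVneq w 0; first by exists 0; rewrite /rescale scaler0.
have e0 := enorm_gt0 w0; have g0 := gauge_gt0 w0.
have c0 : 0 <= gauge w / enorm w by rewrite divr_ge0 // ltW.
exists ((gauge w / enorm w) *: w).
rewrite /rescale enormZ ger0_norm // gaugeZ // scalerA.
rewrite (_ : _ * _ = 1) ?scale1r //; field.
by rewrite !lt0r_neq0.
Qed.

Let rescale_point_continuous v : continuous (fun w => point (rescale w) v).
Proof.
(* Division by the gauge puts the point on the simplex, whose coordinates lie between 0 and 1;
   subtracting the barycenter leaves a number of absolute value at most 1. *)
have ratio_le w : `|z w v / gauge w| <= 1.
  have [->|w0] := eqVneq w 0.
    rewrite -(scale0r 0) zZ gaugeZ // !mul0r normr0; exact: ler01.
  have g0 := gauge_gt0 w0.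
  have gi : 0 <= (gauge w)^-1 by rewrite invr_ge0 ltW.
  have gx : geom_simplex R s (point ((gauge w)^-1 *: w)).
    by apply/point_simplex; rewrite gaugeZ // mulVf // lt0r_neq0.
  have [x0 _ _] := gx; have := x0 v; have := geom_simplex_le1 v gx.
  have -> : point ((gauge w)^-1 *: w) v = (v \in s)%:R / m + z w v / gauge w.
    by rewrite /point zZ (mulrC (gauge w)^-1).
  have [mi0 mi1] : 0 < m^-1 /\ m^-1 <= 1 by rewrite invr_gt0 m_gt0 invf_le1.
  move: (z w v / gauge w) (m^-1) mi0 mi1 => t mi mi0 mi1.
  rewrite ler_norml; case: (v \in s) => /=; rewrite ?mul1r ?mul0r => h1 h2;
    by apply/andP; split; lra.
have ratio_cont w : w != 0 -> continuous_at w (fun w => z w v / gauge w).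
  move=> w0; have g0 := lt0r_neq0 (gauge_gt0 w0).
  exact: (cvgM (@z_continuous v w) (cvgV g0 (@gauge_continuous w))).
have rc := radial_continuous ratio_le ratio_cont.
rewrite (_ : (fun _ => _) = fun w => (v \in s)%:R / m + enorm w * (z w v / gauge w)).
  move=> w; have h1 : continuous_at w (fun=> (v \in s)%:R / m : R) by exact: cst_continuous.
  exact: (cvgD h1 (rc w)).
by apply/funext => w; rewrite /point zZ; congr (_ + _); rewrite -!mulrA; congr (_ * _); rewrite mulrC.
Qed.

Lemma parametrizes_simplex_vertex : exists G : 'rV[R]_n -> nat -> R,
  parametrizes G (simplex s) (simplex_bd s).
Proof.
exists (fun w => point (rescale w)); split.
- exact: rescale_point_continuous.
- by move=> w w' _ _ /point_inj/rescale_inj.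
- have simplexP x : carrier R (simplex s) x <-> geom_simplex R s x.
    split=> [/carrierP[f + gx]|gx].
      by rewrite fpowersetE => fs; case: ((geom_simplex_subset x fs).1 gx).
    by apply/carrierP; exists s; rewrite // fpowersetE fsubset_refl.
  move=> x; rewrite simplexP; split=> [gx|[w /unit_ballE w1 <-]].
    have [u ux] := point_surj gx; have [w wu] := rescale_surj u.
    exists w; last by rewrite wu.
    by apply/unit_ballE; rewrite -gauge_rescale wu; apply/point_simplex; rewrite ux.
  by apply/point_simplex; rewrite gauge_rescale.
- have bdP x : carrier R (simplex_bd s) x <->
      geom_simplex R s x /\ exists2 v, v \in s & x v = 0.
    split=> [/carrierP[f + gx]|[gx [v vs xv]]].
      rewrite in_simplex_bd => /andP[fs /fsubsetPn[v vs vf]].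
      by have [gs xf] := (geom_simplex_subset x fs).1 gx; split=> //; exists v => //; exact: xf.
    apply/carrierP; exists (s `\ v)%fset.
      by rewrite in_simplex_bd fsubD1set; apply/negP => /fsubsetP/(_ v vs); rewrite fsetD11.
    apply/(geom_simplex_subset x (fsubD1set _ v)); split=> // u us.
    by rewrite !inE us andbT negbK => /eqP->.
  move=> x; rewrite bdP; split=> [[gx xv]|[w /unit_sphereE w1 <-]].
    have [u ux] := point_surj gx; have [w wu] := rescale_surj u.
    exists w; last by rewrite wu.
    apply/unit_sphereE; rewrite -gauge_rescale wu.
    by apply/point_bd; rewrite ?ux //; apply/point_simplex; rewrite ux.
  have g1 : gauge (rescale w) <= 1 by rewrite gauge_rescale w1.
  split; first exact/point_simplex.
  by apply/(point_bd g1); rewrite gauge_rescale.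
Qed.

End StandardBall.

Lemma parametrizes_simplex (R : realType) n (s : face) : #|` s| = n.+1 ->
  exists G : 'rV[R]_n -> nat -> R, parametrizes G (simplex s) (simplex_bd s).
Proof.
move=> cs; have /fset0Pn[v vs] : s != fset0 by rewrite -cardfs_gt0 cs.
exact: parametrizes_simplex_vertex cs vs.
Qed.

(** A continuous injection of a compact space into a Hausdorff one is a homeomorphism onto its
    image: closed parts of the ball have compact, hence closed, images. Outside the carrier the
    inverse takes the default value 0. *)
Lemma parametrizes_ball (R : realType) n (G : 'rV[R]_n -> nat -> R) B X :
  parametrizes G B X -> homeomorphic (carrier R B) (unit_ball R n).
Proof.
move=> [Gc Ginj GB _].
pose g : 'rV[R]_n -> {ptws nat -> R} := G.
have gc : continuous g.
  by move=> w; apply/pointwise_cvgP => [|v]; [exact/fmap_filter/nbhs_filter|exact: Gc].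
pose f (x : {ptws nat -> R}) : 'rV[R]_n :=
  xget 0 [set w | unit_ball R n w /\ g w = x].
have fP x : carrier R B x -> unit_ball R n (f x) /\ g (f x) = x.
  by move=> /GB[w w1 Gw]; apply: (@xgetPex _ 0 [set w | unit_ball R n w /\ g w = x]); exists w.
have gf w : unit_ball R n w -> f (g w) = w.
  move=> w1; have [|u1 gu] := fP (g w); first by apply/GB; exists w.
  exact: Ginj.
exists f, g; split.
- by move=> x /fP[].
- by move=> w w1; apply/GB; exists w.
- by move=> x /set_mem/fP[].
- by move=> w /set_mem; exact: gf.
split; last exact: continuous_subspaceT.
apply/continuous_closedP => C Cc; apply/closed_subspaceP.
exists (g @` (unit_ball R n `&` C)).
  apply: compact_closed; first exact: hausdorff_product.
  apply: continuous_compact; first exact: continuous_subspaceT.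
  by apply: compact_closedI => //; exact: unit_ball_compact.
apply/seteqP; split=> x [].
  by move=> [w [w1 Cw] <-] Bx; split=> //; change (C (f (g w))); rewrite gf.
by move=> Cx Bx; have [w1 gw] := fP x Bx; split=> //; exists (f x).
Qed.

(** * Lifting bistellar moves to shelling moves *)

Local Open Scope fset_scope.
Local Open Scope nat_scope.

Lemma face_dim_ltE (b : face) (k : nat) : (face_dim b < k%:Z)%R <-> #|` b| <= k.
Proof. by rewrite /face_dim; move: #|` b| => x; lia. Qed.

Lemma face_dim_addE n (a b : face) : [disjoint a & b]%fset ->
  (face_dim a + face_dim b = n%:Z - 1)%R <-> #|` a `|` b| = n.+1.
Proof.
move=> ab; have : #|` a `|` b| = #|` a| + #|` b|.
  by rewrite -cardfsUI (disjoint_fsetI0 ab) cardfs0 addn0.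
rewrite /face_dim; move: #|` a `|` b| #|` a| #|` b| => x y z; lia.
Qed.

Lemma pure_card_has_dim n (X : complex) : pure_card n X -> has_dim (n%:Z - 1)%R X.
Proof.
move=> [[X0 _] Xf]; split.
  have [s /facet_overP[sX cs _]] := Xf _ X0.
  by exists s => //; exact/face_dimE.
move=> f /Xf[s /facet_overP[_ cs /fsubset_leq_card]].
by rewrite cs /face_dim; move: #|` f| => x; lia.
Qed.

Lemma bistellar_moveE n (a b : face) (X Y : complex) :
  normal_pseudomanifold n X -> bistellar_move (n%:Z - 1)%R a b X Y ->
  [/\ a != fset0, b != fset0 & [disjoint a & b]%fset] /\
  [/\ #|` a `|` b| = n.+1,
      forall f, f `<=` a `|` b -> (f \in X) = ~~ (b `<=` f) & Y = flip X a b].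
Proof.
move=> nX [_ [a0 b0 ab /(face_dim_addE _ ab) cab] /(faces_withinP _ ab) Xab ->].
by do !split=> //; exact: (flipE nX).
Qed.

Lemma bistellar_move_flip n (a b : face) (X : complex) :
  normal_pseudomanifold n X -> a != fset0 -> b != fset0 ->
  [disjoint a & b]%fset -> #|` a `|` b| = n.+1 ->
  (forall f, f `<=` a `|` b -> (f \in X) = ~~ (b `<=` f)) ->
  bistellar_move (n%:Z - 1)%R a b X (flip X a b).
Proof.
move=> nX a0 b0 ab cab Xab; split.
- by case: nX => Xp _ _; exact: pure_card_has_dim.
- by split=> //; exact/(face_dim_addE _ ab).
- exact/faces_withinP.
- exact/esym/(flipE nX).
Qed.

Lemma shelled_boundary n k (s : face) (B : complex) : #|` s| = n.+1 -> k <= n ->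
  clos_refl_trans complex (shelling_step n%:Z k) (simplex s) B -> thin n.+1 B ->
  normal_pseudomanifold n (boundary n%:Z B) /\
  clos_refl_trans complex (bistellar_step (n%:Z - 1)%R k)
    (simplex_bd s) (boundary n%:Z B).
Proof.
move=> cs kn reach; elim: {reach}(clos_rt_rtn1 _ _ _ _ reach) => {B} [_|B B' step _ IH Bt'].
  rewrite (boundary_simplex cs); split; first exact: normal_simplex_bd.
  exact: rt_refl.
have [a [b [/shelling_moveE[[Bp B'E b0] [ab cab Bab]] /face_dim_ltE cb]]] := step.
have Bt : thin n.+1 B.
  apply: thin_sub Bt' => f t /facet_overP[tB ct ft].
  by apply/facet_overP; rewrite B'E in_glue tB.
have [nB reach] := IH Bt.
(* With [a] empty, [b] would be a whole facet of [n.+1] vertices, while the index bound allows at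
   most [k <= n]. *)
have a0 : a != fset0.
  apply: contraL kn => /eqP a0; rewrite -ltnNge.
  by move: cab; rewrite a0 fset0U => cbn; rewrite -cbn.
rewrite B'E in Bt' *.
have Xab := boundary_within Bp cab Bab Bt'.
have star := link_of_flip_face nB b0 ab cab Xab.
rewrite (boundary_glue Bp ab cab Bab star); split; first exact: normal_flip.
apply: rt_trans reach _; apply: rt_step; exists a, b; split.
  exact: bistellar_move_flip.
exact/face_dim_ltE.
Qed.

Definition stacked_lift (R : realType) n k (s : face) (B X : complex) :=
  [/\ normal_pseudomanifold n X,
      boundary n%:Z B = X,
      [/\ pure_card n.+1 B, thin n.+1 B & strongly_connected n.+1 B fset0],
      clos_refl_trans complex (shelling_step n%:Z k) (simplex s) B
    & (forall f, f \in B -> #|` f| + k <= n -> f \in X) /\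
      exists G : 'rV[R]_n -> nat -> R, parametrizes G B X].

Lemma stellated_lift (R : realType) n k (s : face) (X : complex) :
  #|` s| = n.+1 -> k.*2 <= n ->
  clos_refl_trans complex (bistellar_step (n%:Z - 1)%R k) (simplex_bd s) X ->
  exists B, stacked_lift R n k s B X.
Proof.
move=> cs kn reach; elim: {reach}(clos_rt_rtn1 _ _ _ _ reach) => {X} [|X X' step _].
  exists (simplex s); split.
  - exact: normal_simplex_bd.
  - exact: boundary_simplex.
  - split; [exact: pure_simplex|exact: thin_simplex|exact: connected_simplex].
  - exact: rt_refl.
  split; last exact: parametrizes_simplex.
  move=> f; rewrite fpowersetE in_simplex_bd => -> fk /=.
  by apply/negP => /fsubset_leq_card; rewrite cs; lia.
move=> [B [nX bX [Bp Bt Bc] reach [Bk [G GP]]]].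
have [a [b [/(bistellar_moveE nX)[[a0 b0 ab] [cab Xab ->]] /face_dim_ltE cb]]] := step.
have star := link_of_flip_face nX b0 ab cab Xab.
have XB f : f \in X -> f \in B by rewrite -bX; exact: boundary_sub.
(* [b] is too small to be an interior face of the stacked ball [B] *)
have Bab f : f `<=` a `|` b -> (f \in B) = ~~ (b `<=` f).
  move=> fab; apply/idP/idP => [fB|nbf]; last by rewrite XB ?Xab.
  apply/negP => bf; have bB : b \in B by exact: (pure_card_down Bp) bf.
  have : b \in X by apply: Bk => //; lia.
  by rewrite Xab ?fsubsetUr // fsubset_refl.
have Xd : forall f g, f \in X -> g `<=` f -> g \in X.
  by case: nX => Xp _ _; exact: pure_card_down Xp.
exists (glue B (a `|` b)); split.
- exact: normal_flip.
- by rewrite boundary_glue ?bX.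
- split; [exact: glue_pure| |exact: connected_glue].
  by apply: thin_glue => // f fab nbf; rewrite bX Xab.
- apply: rt_trans reach _; apply: rt_step; exists a, b; split.
    exact: shelling_move_glue.
  exact/face_dim_ltE.
split; last first.
  exact: (parametrizes_glue GP a0 b0 ab (pure_card_down Bp) Xd Bab Xab star).
move=> f; rewrite in_glue in_flip => fB fk; apply/andP; split.
  apply/negP => /fsubset_leq_card.
  have := cardfsUI a b; rewrite (disjoint_fsetI0 ab) cardfs0 cab.
  by move: #|` a| #|` f| fk => x y; lia.
by case/orP: fB => [/Bk->//|->]; rewrite ?orbT.
Qed.

Local Open Scope ring_scope.

Theorem proposition2p9 (R : realType) :
  (forall (d : int) (k : nat) (X : complex),
     triangulated_sphere R d X -> 2 * k%:Z - 1 <= d ->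
     (stellated d k X <->
      exists B : complex,
        [/\ triangulated_ball R (d + 1) B, shelled (d + 1) k B
          & X = boundary (d + 1) B])) /\
  (forall (d : int) (k : nat) (X : complex),
     triangulated_sphere R d X -> stellated d k X -> 2 * k%:Z - 1 <= d ->
     stacked_sphere R d k X).
Proof.
have nE (n : nat) : n%:Z - 1 + 1 = n%:Z by lia.
have nE1 (n : nat) : n%:Z = n.+1%:Z - 1 by lia.
have lift (n k : nat) X : stellated (n%:Z - 1) k X -> 2 * k%:Z - 1 <= n%:Z - 1 ->
    exists s B, [/\ #|` s| = n.+1, (k <= n)%N & stacked_lift R n k s B X].
  move=> [kn [S [s sd ->] reach]] k2n.
  have cs : #|` s| = n.+1 by apply/face_dimE; rewrite sd nE nE1.
  have [|B BX] := stellated_lift R cs _ reach; first by lia.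
  by exists s, B; split=> //; lia.
have ball (n k : nat) s B X : stacked_lift R n k s B X -> triangulated_ball R n%:Z B.
  move=> [_ _ [[Bs _] _ _] _ [_ [G GP]]]; split=> //; exists n => //.
  exact: parametrizes_ball GP.
split=> d k X sX.
  (* A triangulated sphere has [d = n - 1] for a natural number [n], so the integer bounds become
     bounds on numbers of vertices. *)
  have [_ [n dE _]] := sX; rewrite {}dE nE in sX * => k2n; split.
    move=> /lift/(_ k2n)[s [B [cs kn BX]]]; exists B.
    have [_ bX [Bp Bt Bc] reach _] := BX; split=> //; first exact: ball BX.
    split=> //; first exact/(pseudomanifoldP _ (nE1 n)).
    by exists (simplex s) => //; exists s => //; rewrite nE1; exact/face_dimE.
  move=> [B [_ [kn /(pseudomanifoldP _ (nE1 n))[_ Bt _] [S [s sd ->] reach]] ->]].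
  have cs : #|` s| = n.+1 by apply/face_dimE; rewrite sd nE1.
  split; first by rewrite nE.
  exists (simplex_bd s); first by exists s => //; rewrite nE.
  by have [] := shelled_boundary cs kn reach Bt.
move=> + k2n; have [_ [n dE _]] := sX; rewrite {}dE in sX k2n *.
move=> /lift/(_ k2n)[s [B [cs kn BX]]]; split=> //; rewrite nE.
have [_ bX _ _ [Bk _]] := BX; exists B => //; split=> //; first exact: ball BX.
move=> f fB fk; rewrite bX; apply: Bk => //.
by move: fk; rewrite /face_dim; move: #|` f| => x; lia.
Qed.
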